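(* Let $M$ be a balanced and aligned marking for a permutation $\pi\in S_n$. Then $\pi$ has a perfect tangle whose corresponding marking is $M$.
   Context: Tangles: $S_n$ is the set of permutations of $\{1,\dots,n\}$, $\pi(p)$ the element at position $p$; $\pi=[\dots a\dots b\dots]$ means $a$ occurs before $b$, and $\pi=[\dots ab\dots]$ means $b$ occurs immediately after $a$. The swap $\sigma(i)$ exchanges the elements at positions $i,i+1$. Two permutations are adjacent if one is obtained from the other by swaps $\sigma(p_1),\dots,\sigma(p_k)$ ($k\ge0$) with pairwise $|p_i-p_j|\ge2$. A tangle is a finite sequence $\pi_0,\dots,\pi_m$ with consecutive permutations adjacent; it solves $\pi$ if $\pi_0=\pi$ and $\pi_m$ is the identity (by convention $\pi_0=\pi_1$, $\pi_{m-1}=\pi_m$). In the drawing, element $x$ at time $t$ is at $(p,-t)$ where $\pi_t(p)=x$, and path $x$ is the polyline through these points. A segment is a maximal straight piece of a path; a non-vertical segment is an L-segment if, traversed downward, it moves left, and an R-segment if it moves right. A tangle solving $\pi$ is simple if no two paths cross more than once, and perfect if it is simple and each path has at most one L-segment and at most one R-segment. The marking corresponding to a tangle assigns to each $i$ the string obtained by tracing path $i$ from top to bottom and appending $L$ for each L-segment and $R$ for each R-segment met (vertical segments ignored). Markings: an inversion of $\pi$ is a pair $(a,b)$ with $a>b$ and $\pi=[\dots a\dots b\dots]$. Element $i$ is right if in some inversion $(i,j)$, left if in some inversion $(j,i)$; left-straight if left but not right; right-straight if right but not left; a switchback if both. A marking $M$ (function from $\{1,\dots,n\}$ to strings in $L,R$)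 is a marking for $\pi$ if $M(i)=L$ for left-straight $i$, $M(i)=R$ for right-straight $i$, $M(i)\in\{LR,RL\}$ for switchbacks, and $M(i)=\emptyset$ otherwise. A quadruple $(a,b,c,d)$ is a rec in $\pi$ if $\pi=[\dots a\dots b\dots c\dots d\dots]$ and $\min\{a,b\}>\max\{c,d\}$. Under $M$, $e$ is a left switchback of the rec if $M(e)=RL$, $\pi=[\dots a\dots e\dots b\dots]$, and $e$ is strictly between $c$ and $d$ in value; a right switchback if $M(e)=LR$, $\pi=[\dots c\dots e\dots d\dots]$, and $e$ is strictly between $a$ and $b$ in value. The rec is regular if $a<b$ and $c<d$, irregular otherwise; balanced if it has equally many left and right switchbacks; empty if it has none. $M$ is balanced if every regular rec is balanced and every irregular rec is empty under $M$. $M$ is aligned with $\pi$ if for every pair $a,b$ with $\pi=[\dots ab\dots]$, $M(a)$ starting with $R$ and $M(b)$ starting with $L$, the pair $(a,b)$ is an inversion. *)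

(* Defs.v *)
From HB Require Import structures.
From mathcomp Require Import all_boot all_order all_algebra all_fingroup.

Set Implicit Arguments.
Unset Strict Implicit.
Unset Printing Implicit Defensive.

(** Elements, positions and times are numbered from 0, so that a permutation of
    n elements is some [pi : 'S_n], with [pi p] the element at position [p] and
    [(pi^-1)%g x] the position of the element [x]. *)

Section Permutations.
Variable n : nat.
Implicit Types (pi rho : 'S_n) (a b x : 'I_n) (i : 'I_n.-1).

Definition pos pi x : 'I_n := (pi^-1)%g x.

Definition before pi a b : bool := pos pi a < pos pi b.

Definition immediately_before pi a b : bool := pos pi b == (pos pi a).+1 :> nat.

Lemma ord_succ_subproof i : i.+1 < n.
Proof. by rewrite -ltn_predRL. Qed.

(* [i : 'I_n.-1] ranges over the positions that have a successor. *)
Definition ord_this i : 'I_n := widen_ord (leq_pred n) i.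
Definition ord_succ i : 'I_n := Ordinal (ord_succ_subproof i).

(* The product of ['S_n] composes left to right, hence the swap acts on
   positions here: [swap i pi p = pi (tperm i i.+1 p)]. *)
Definition swap i pi : 'S_n := (tperm (ord_this i) (ord_succ i) * pi)%g.

Definition far (i j : 'I_n.-1) : bool := (i.+2 <= j) || (j.+2 <= i).

Definition adjacent pi rho : Prop :=
  exists2 s : seq 'I_n.-1, pairwise far s & rho = foldr swap pi s.

End Permutations.

Inductive letter : Type := L | R.

Definition bool_of_letter (l : letter) : bool := if l is R then true else false.
Definition letter_of_bool (b : bool) : letter := if b then R else L.
Lemma bool_of_letterK : cancel bool_of_letter letter_of_bool.
Proof. by case. Qed.
HB.instance Definition _ := Equality.copy letter (can_type bool_of_letterK).

Definition marking (n : nat) : Type := 'I_n -> seq letter.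

Section Tangles.
Variable n : nat.
Implicit Types (pi : 'S_n) (T : seq 'S_n) (a b x : 'I_n) (s t u : nat).

(* The default value of [nth] is irrelevant: [t] is always used below [size T]. *)
Definition perm_at T t : 'S_n := nth 1%g T t.

Definition final_time T : nat := (size T).-1.

Definition tangle T : Prop :=
  0 < size T /\
  forall t, t < final_time T -> adjacent (perm_at T t) (perm_at T t.+1).

Definition solves T pi : Prop :=
  [/\ tangle T,
      perm_at T 0 = pi,
      perm_at T (final_time T) = 1%g,
      0 < final_time T &
      perm_at T 0 = perm_at T 1 /\
      perm_at T (final_time T).-1 = perm_at T (final_time T)].

Definition path_pos T x t : nat := pos (perm_at T t) x.

Definition step T x t : int := ((path_pos T x t.+1)%:Z - (path_pos T x t)%:Z)%R.

(* The piece of path [x] between times [s] and [t] is straight.  The polyline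
   can only bend at integer times, so comparing unit steps is enough. *)
Definition straight T x s t : bool :=
  [&& s < t, t <= final_time T &
      all (fun u => step T x u == step T x s) (iota s (t - s))].

Definition segment T x s t : bool :=
  straight T x s t &&
  [forall s' : 'I_(size T), forall t' : 'I_(size T),
     [&& s' <= s, t <= t' & straight T x s' t'] ==>
     ((s' == s :> nat) && (t' == t :> nat))].

(* The segments of path [x], as pairs (start time, end time), listed from top
   to bottom. *)
Definition segments T x : seq (nat * nat) :=
  [seq st <- [seq (s, t) | s <- iota 0 (size T), t <- iota 0 (size T)]
     | segment T x st.1 st.2].

Definition segment_letter T x (st : nat * nat) : option letter :=
  if path_pos T x st.2 < path_pos T x st.1 then Some L
  else if path_pos T x st.1 < path_pos T x st.2 then Some R
  else None.

Definition nb_segments T x (l : letter) : nat :=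
  count (fun st => segment_letter T x st == Some l) (segments T x).

(* Distinct paths are at distinct positions at integer times, so they cross
   between times [t] and [t.+1] exactly when their left-to-right order changes. *)
Definition nb_crossings T a b : nat :=
  count (fun t => before (perm_at T t) a b != before (perm_at T t.+1) a b)
        (iota 0 (final_time T)).

Definition simple_tangle T pi : Prop :=
  solves T pi /\ forall a b, a != b -> nb_crossings T a b <= 1.

Definition perfect_tangle T pi : Prop :=
  simple_tangle T pi /\
  forall x, nb_segments T x L <= 1 /\ nb_segments T x R <= 1.

Definition tangle_marking T : marking n :=
  fun x => pmap (segment_letter T x) (segments T x).

End Tangles.

Section Markings.
Variable n : nat.
Implicit Types (pi : 'S_n) (M : marking n) (a b c d e i j : 'I_n).

Definition inversion pi a b : bool := (b < a) && before pi a b.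

Definition right_elt pi i : bool := [exists j, inversion pi i j].
Definition left_elt pi i : bool := [exists j, inversion pi j i].

Definition left_straight pi i : bool := left_elt pi i && ~~ right_elt pi i.
Definition right_straight pi i : bool := right_elt pi i && ~~ left_elt pi i.
Definition switchback pi i : bool := left_elt pi i && right_elt pi i.

Definition marking_for pi M : Prop :=
  forall i,
  [/\ left_straight pi i -> M i = [:: L],
      right_straight pi i -> M i = [:: R],
      switchback pi i -> M i = [:: L; R] \/ M i = [:: R; L] &
      ~~ left_elt pi i && ~~ right_elt pi i -> M i = [::]].

Definition rec pi a b c d : bool :=
  [&& before pi a b, before pi b c, before pi c d & maxn c d < minn a b].

Definition strictly_between (x y e : nat) : bool := minn x y < e < maxn x y.

Definition left_switchbacks pi M a b c d : {set 'I_n} :=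
  [set e | [&& M e == [:: R; L], before pi a e, before pi e b
             & strictly_between c d e]].

Definition right_switchbacks pi M a b c d : {set 'I_n} :=
  [set e | [&& M e == [:: L; R], before pi c e, before pi e d
             & strictly_between a b e]].

Definition regular a b c d : bool := (a < b) && (c < d).

Definition balanced_rec pi M a b c d : Prop :=
  #|left_switchbacks pi M a b c d| = #|right_switchbacks pi M a b c d|.

Definition empty_rec pi M a b c d : Prop :=
  left_switchbacks pi M a b c d = set0 /\ right_switchbacks pi M a b c d = set0.

Definition balanced pi M : Prop :=
  forall a b c d, rec pi a b c d ->
    (regular a b c d -> balanced_rec pi M a b c d) /\
    (~~ regular a b c d -> empty_rec pi M a b c d).

Definition aligned pi M : Prop :=
  forall a b, immediately_before pi a b ->
    ohead (M a) = Some R -> ohead (M b) = Some L -> inversion pi a b.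

End Markings.

(* Main.v *)
(** Induct on the number of inversions.  Let [b] be the first element whose
    string starts with L; its predecessor [a] starts with R, and [(a, b)] is an
    inversion because [M] is aligned.  Swapping [a] and [b], and dropping the
    first letter of [M a] (of [M b]) when no right (left) inversion of [a] (of
    [b]) remains, gives a balanced aligned marking again, hence a tangle for it.
    The swap can be put on top of that tangle if [a] and [b] first move at the
    same time, whenever both still have to move on.  Let [p] be the gap between
    them.  If no swap of the tangle is at [p], then the two sides of [p] do not
    interact and can be delayed separately.  Otherwise let the first such swap,
    at time [s], be between [a'] and [b'].  Between that swap and the new one,
    the paths of [a] and [b'] bound a triangle to the right of [p], and those of
    [b] and [a'] one to the left.  The paths that enter the right triangle turn
    in it: they are the right switchbacks of the rec [(a', a, b, b')], so [a]
    starts at time [s - 1 - 2r] for their number [r].  Likewise [b] starts at time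
    [s - 1 - 2l] with [l] the number of left switchbacks, and [l = r] by
    balance. *)

Require Import Defs.
From HB Require Import structures.
From mathcomp Require Import all_boot all_order all_algebra all_fingroup.
From mathcomp Require Import zify.

Set Implicit Arguments.
Unset Strict Implicit.
Unset Printing Implicit Defensive.

(** * Motions *)

Definition rmove n (P : nat -> 'I_n -> 'I_n) t x : bool := P t.+1 x == (P t x).+1 :> nat.
(** With a truncated predecessor in place of this successor, a path resting at position 0 would
    count as moving left. *)
Definition lmove n (P : nat -> 'I_n -> 'I_n) t x : bool := P t x == (P t.+1 x).+1 :> nat.

(* [P t x] is the position of the element [x] at time [t]. *)
Record motion n (M : marking n) (P : nat -> 'I_n -> 'I_n) : Prop := Motion {
  motion_inj t : injective (P t);
  motion_step t x : (P t.+1 x <= (P t x).+1) && (P t x <= (P t.+1 x).+1);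
  motion_mono t (x y : 'I_n) : x < y -> P t x < P t y -> P t.+1 x < P t.+1 y;
  rmove_convex s t u x :
    rmove P s x -> rmove P u x -> s <= t <= u -> rmove P t x;
  lmove_convex s t u x :
    lmove P s x -> lmove P u x -> s <= t <= u -> lmove P t x;
  lmove_rmove s u x : lmove P s x -> rmove P u x -> s < u -> M x = [:: L; R];
  rmove_lmove s u x : rmove P s x -> lmove P u x -> s < u -> M x = [:: R; L];
  motion_final : exists N, forall t, N <= t -> P t =1 id }.

Lemma card_below n (f : 'I_n -> 'I_n) k :
  injective f -> k <= n -> #|[set x | f x < k]| = k.
Proof.
move=> f_inj le_kn.
have -> : [set x | f x < k] = f @^-1: [set i : 'I_n | i < k].
  by apply/setP=> x; rewrite !inE.
rewrite on_card_preimset; last by apply: onW_bij; apply: injF_bij.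
rewrite -sum1_card; under eq_bigl do rewrite inE.
by rewrite (big_ord_narrow le_kn) sum1_card card_ord.
Qed.

(** * Crossings, runs of moves and the triangle beside a gap *)

Section MotionTheory.
Variables (n : nat) (M : marking n) (P : nat -> 'I_n -> 'I_n).
Hypothesis P_motion : motion M P.
Implicit Types (x y a b f : 'I_n) (s t u m p : nat).

Lemma motion_neq t x y : x != y -> P t x != P t y :> nat.
Proof. by move=> neq; apply: contra neq => /eqP/val_inj/(motion_inj P_motion) ->. Qed.

Lemma motion_mono_le s t x y :
  s <= t -> x < y -> P s x < P s y -> P t x < P t y.
Proof.
move=> /subnK <- lt_xy lt_s; elim: (t - s) => // k.
exact: (motion_mono P_motion).
Qed.

(** Pigeonhole: the first [k] positions hold [k] elements at both times, so when [x] leaves them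
    another element enters, and a path moves by at most one position per step. *)
Lemma rmove_cross t x : rmove P t x ->
  exists2 y, P t y = (P t x).+1 :> nat & P t.+1 y = P t x :> nat.
Proof.
move=> x_moves; set k := (P t x).+1.
have lt_kn : k <= n by exact: ltn_ord.
have [y] : exists y, y \in [set z | P t.+1 z < k] :\: [set z | P t z < k].
  apply/set0Pn; rewrite -subset0; apply/negP; rewrite subset0 setD_eq0 => sub.
  have : [set z | P t.+1 z < k] \proper [set z | P t z < k].
    rewrite properE sub; apply/subsetPn; exists x; rewrite !inE /k //.
    by move: x_moves; rewrite /rmove; lia.
  by move/proper_card; rewrite !card_below ?ltnn //; apply: motion_inj P_motion _.
rewrite !inE => /andP[ge lt]; have := motion_step P_motion t y.
by exists y; lia.
Qed.

Lemma lmove_cross t x : lmove P t x ->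
  exists2 y, P t y = P t.+1 x :> nat & P t.+1 y = P t x :> nat.
Proof.
rewrite /lmove => x_moves; set k := P t x : nat.
have lt_kn : k <= n by apply: ltnW; exact: ltn_ord.
have [y] : exists y, y \in [set z | P t z < k] :\: [set z | P t.+1 z < k].
  apply/set0Pn; rewrite -subset0; apply/negP; rewrite subset0 setD_eq0 => sub.
  have : [set z | P t z < k] \proper [set z | P t.+1 z < k].
    rewrite properE sub; apply/subsetPn; exists x; rewrite !inE /k //; lia.
  by move/proper_card; rewrite !card_below ?ltnn //; apply: motion_inj P_motion _.
rewrite !inE => /andP[ge lt]; have := motion_step P_motion t y.
by exists y; lia.
Qed.

(** With unit steps, two paths can exchange their order within one step only from neighbouring
    positions and by moving towards each other. *)
Lemma crossing s u x y : s <= u -> P s x < P s y -> P u y < P u x ->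
  exists m, [/\ s <= m < u, rmove P m x, lmove P m y & P m y = (P m x).+1 :> nat].
Proof.
move=> /subnK <-; elim: (u - s) => [|k IH] lt_s lt_u; first by rewrite add0n in lt_u; lia.
have neq : x != y by apply: contraTneq lt_s => ->; rewrite ltnn.
have := motion_neq (k + s) neq; rewrite neq_ltn => /orP[lt_k|gt_k].
  exists (k + s); rewrite addSn in lt_u.
  have := motion_step P_motion (k + s) x; have := motion_step P_motion (k + s) y.
  by rewrite /rmove /lmove; split; lia.
by have [m [? ? ? ?]] := IH lt_s gt_k; exists m; split=> //; lia.
Qed.

Lemma final_crossing s x y : y < x -> P s x < P s y ->
  exists m, [/\ s <= m, rmove P m x, lmove P m y & P m y = (P m x).+1 :> nat].
Proof.
have [N PN] := motion_final P_motion => lt_yx lt_s.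
have [|m [/andP[? _] ? ? ?]] := crossing (leq_maxl s N) lt_s.
  by rewrite !PN ?leq_maxr.
by exists m.
Qed.

(** The neighbour that takes the place of [x] must be smaller, since an ordered pair never becomes
    inverted. For the same reason it cannot have started to the left of [x]. Hence every swap of a
    motion resolves an inversion present at time 0. *)
Lemma rmove_inversion t x : rmove P t x ->
  exists y, [/\ y < x, P 0 x < P 0 y, lmove P t y & P t y = (P t x).+1 :> nat].
Proof.
move=> x_moves; have [y Py Py'] := rmove_cross x_moves.
move: x_moves; rewrite /rmove => x_moves.
have lt_yx : y < x.
  rewrite ltnNge leq_eqVlt; apply/negP => /orP[/eqP/val_inj eq_xy|lt_xy].
    by move: Py; rewrite eq_xy; lia.
  by have := motion_mono P_motion lt_xy (t := t); lia.
exists y; split=> //; last by rewrite /lmove; lia.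
rewrite ltnNge leq_eqVlt; apply/negP => /orP[/eqP/val_inj/(motion_inj P_motion)|].
  by move=> eq_xy; move: lt_yx; rewrite eq_xy ltnn.
by move/(motion_mono_le (leq0n t) lt_yx); lia.
Qed.

Lemma lmove_inversion t x : lmove P t x ->
  exists y, [/\ x < y, P 0 y < P 0 x, rmove P t y & P t x = (P t y).+1 :> nat].
Proof.
move=> x_moves; have [y Py Py'] := lmove_cross x_moves.
have y_moves : rmove P t y by move: x_moves; rewrite /rmove /lmove; lia.
have [z [? ? ? Pz]] := rmove_inversion y_moves; exists y; rewrite y_moves.
suff <- : z = x by [].
by apply: (motion_inj P_motion (t := t)); apply: ord_inj; move: x_moves; rewrite /lmove; lia.
Qed.

Lemma static s u x : s <= u ->
  (forall t, s <= t < u -> ~~ rmove P t x /\ ~~ lmove P t x) -> P u x = P s x.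
Proof.
move=> /subnK <-; elim: (u - s) => // k IH fix_x; rewrite -IH; last first.
  by move=> t lt_t; apply: fix_x; lia.
have [|] := fix_x (k + s); first by lia.
have := motion_step P_motion (k + s) x.
by rewrite /rmove /lmove addSn => *; apply: ord_inj; lia.
Qed.

Lemma rmove_run s u x : s <= u -> (forall t, s <= t < u -> rmove P t x) ->
  P u x = P s x + (u - s) :> nat.
Proof.
move=> le_su; rewrite -{1 2}(subnK le_su); elim: (u - s) => [|k IH] x_moves.
  by rewrite add0n; lia.
have := x_moves (k + s); rewrite /rmove addSn => /(_ _)/eqP -> //; last by lia.
by rewrite IH => [|t lt_t]; [lia | apply: x_moves; lia].
Qed.

Lemma lmove_run s u x : s <= u -> (forall t, s <= t < u -> lmove P t x) ->
  P s x = P u x + (u - s) :> nat.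
Proof.
move=> le_su; rewrite -{1 2}(subnK le_su); elim: (u - s) => [|k IH] x_moves.
  by rewrite add0n; lia.
rewrite IH => [|t lt_t]; last by apply: x_moves; lia.
by have := x_moves (k + s); rewrite /lmove addSn => /(_ _)/eqP -> //; lia.
Qed.

Lemma lmove_not_rmove t x : lmove P t x -> rmove P t x = false.
Proof. by rewrite /rmove /lmove => *; lia. Qed.

(** No element passes from the left of [a] to its right during the run, as this would need a left
    move of [a]. So the set is a difference of two nested sets, whose sizes are the positions of [a]
    at times [m] and [t]. *)
Lemma card_crossed t m a : t <= m -> (forall u, t <= u < m -> rmove P u a) ->
  #|[set f | (P t a < P t f) && (P m f < P m a)]| = m - t.
Proof.
move=> le_tm a_moves.
have keep f u : t <= u <= m -> P t f < P t a -> P u f < P u a.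
  move=> /andP[le_tu le_um] lt_fa; rewrite ltnNge leq_eqVlt; apply/negP => /orP[].
    by move=> /eqP/ord_inj/(motion_inj P_motion) eq_fa; rewrite eq_fa ltnn in lt_fa.
  move=> lt_af; have [v [v_in _ a_left _]] := crossing le_tu lt_fa lt_af.
  by have := a_moves v; rewrite lmove_not_rmove //; lia.
have -> : [set f | (P t a < P t f) && (P m f < P m a)] =
          [set f | P m f < P m a] :\: [set f | P t f < P t a].
  apply/setP=> f; rewrite !inE ltnNge leq_eqVlt negb_or andbC [RHS]andbC.
  case: (boolP (P m f < P m a)) => //= lt_fa; case: eqP => //.
  by move=> /ord_inj/(motion_inj P_motion) eq_fa; rewrite eq_fa ltnn in lt_fa.
rewrite cardsD (setIidPr _); last first.
  by apply/subsetP=> f; rewrite !inE; apply: keep; lia.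
rewrite !card_below; try exact: motion_inj P_motion _; try exact: ltnW (ltn_ord _).
by have := rmove_run le_tm a_moves; lia.
Qed.

(* The elements to the right of gap [p] that cross [a] between its first move
   and its crossing with [b'] are trapped in the triangle formed by the paths
   of [a] and [b'] and the gap, so they turn and leave it through [b']. *)
Lemma right_gap_time p s t a a' b' :
  (forall u x, u <= s -> (P u x <= p) = (P 0 x <= p)) ->
  P 0 a = p.+1 :> nat ->
  (forall u, u < t -> ~~ rmove P u a /\ ~~ lmove P u a) -> rmove P t a ->
  P s a' = p :> nat -> rmove P s a' -> P s b' = p.+1 :> nat -> lmove P s b' ->
  [/\ b' < a, P 0 a < P 0 b' &
      s = t.+1 + 2 * #|[set f | [&& M f == [:: L; R], P 0 a < P 0 f < P 0 b'
                                 & a' < f < a]]|].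
Proof.
move=> closed Pa a_static a_t Pa' a'_s Pb' b'_s.
have inj u x y := @motion_neq u x y.
have Pta u : u <= t -> P u a = p.+1 :> nat.
  by move=> le_ut; rewrite (static (leq0n u)) => // v /andP[_ ?]; apply: a_static; lia.
have a_right u : u <= s -> p < P u a by move=> le_us; rewrite ltnNge closed // Pa; lia.
(* A left move would exchange [a] with an element that started to its left and so is still at a
   position at most [p]; [a] would land on the wrong side of the gap. *)
have a_nleft u : u < s -> ~~ lmove P u a.
  move=> lt_us; apply/negP=> a_left.
  have [c [_ lt_ca _ Puc]] := lmove_inversion a_left.
  have := closed u c (ltnW lt_us); have := a_right u.+1 lt_us.
  by move: a_left; rewrite /lmove; lia.
have lt_ts : t < s.
  rewrite ltnNge; apply/negP=> le_st; have eq_b'a : b' = a.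
    by apply: (motion_inj P_motion (t := s)); apply: ord_inj; rewrite Pb' Pta.
  subst b'; have [eq_st|lt_st] : s = t \/ s < t by lia.
    by subst s; rewrite lmove_not_rmove in a_t.
  by have [_] := a_static s lt_st; rewrite b'_s.
have a_grows u v : u <= v <= s -> P u a <= P v a.
  move=> /andP[/subnK <-]; elim: (v - u) => // k IH lt_s.
  apply: leq_trans (IH _) _; first by lia.
  have := a_nleft (k + u) lt_s; have := motion_step P_motion (k + u) a.
  by rewrite /lmove addSn; lia.
have lt_p1 : p.+1 < P s a.
  have := a_grows t.+1 s; have := Pta t (leqnn t); move: a_t; rewrite /rmove; lia.
have neq_ab' : a != b' by apply: contraTneq lt_p1 => ->; rewrite Pb' ltnn.
have Pab' : P 0 a < P 0 b'.
  by have := closed s b' (leqnn s); have := inj 0 _ _ neq_ab'; lia.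
have lt_b'a : b' < a.
  rewrite ltnNge leq_eqVlt; apply/negP=> /orP[/eqP/ord_inj/eqP|lt_ab']; first exact/negP.
  by have := motion_mono_le (leq0n s) lt_ab' Pab'; lia.
split=> //.
(* The apex of the triangle: at time [s], [b'] is at [p.+1] and [a] further right, so they have
   crossed before. *)
have [m [m_in a_m b'_m Pmb']] : exists m, [/\ 0 <= m < s, rmove P m a,
    lmove P m b' & P m b' = (P m a).+1 :> nat].
  by apply: crossing => //; lia.
have le_tm : t <= m.
  by rewrite leqNgt; apply/negP=> /a_static[/negP[]].
have a_moves u : t <= u < m -> rmove P u a.
  by move=> u_in; apply: (rmove_convex P_motion) a_t a_m _; lia.
have b'_moves u : m <= u < s -> lmove P u b'.
  by move=> u_in; apply: (lmove_convex P_motion) b'_m b'_s _; lia.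
have Pma := rmove_run le_tm a_moves; rewrite (Pta t) // in Pma.
have Pmb : P m b' = P s b' + (s - m) :> nat by apply: lmove_run => //; lia.
have lt_b'a' : b' < a'.
  rewrite ltnNge leq_eqVlt; apply/negP=> /orP[/eqP/ord_inj eq_ab|lt_ab'].
    by move: Pa'; rewrite eq_ab; lia.
  have := motion_mono P_motion lt_ab' (t := s).
  by move: a'_s b'_s; rewrite /rmove /lmove; lia.
have -> : [set f | [&& M f == [:: L; R], P 0 a < P 0 f < P 0 b' & a' < f < a]] =
    [set f | (P t a < P t f) && (P m f < P m a)].
  apply/setP=> f; rewrite !inE; apply/idP/idP.
    (* If [a] had not passed [f] by time [m], then [f] would lie beyond [b'], which started to its
       right. So [f] would move right across [b'] and only afterwards left across [a], against
       [M f]. *)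
    case/and3P=> /eqP Mf /andP[lt_af lt_fb'] /andP[lt_a'f lt_fa].
    have [u1 [_ u1_r u1_l _]] := final_crossing lt_fa lt_af.
    have neq_fa : f != a by apply: contraTneq lt_fa => ->; rewrite ltnn.
    have lt_b'f : b' < f by apply: ltn_trans lt_a'f.
    have neq_fb' : f != b' by apply: contraTneq lt_b'f => ->; rewrite ltnn.
    have lt_taf : P t a < P t f.
      rewrite ltnNge leq_eqVlt (negPf (inj t _ _ neq_fa)) /=; apply/negP=> lt_tfa.
      have [v [v_in v_r _ _]] := crossing (leq0n t) lt_af lt_tfa.
      by have [] := a_static v; [clear -v_in; lia | rewrite v_r].
    rewrite lt_taf ltnNge leq_eqVlt eq_sym (negPf (inj m _ _ neq_fa)) /=.
    apply/negP=> lt_maf; have [u [le_mu _ u_l _]] := final_crossing lt_fa lt_maf.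
    have lt_b'f1 : P m.+1 b' < P m.+1 f.
      have := inj m _ _ neq_fb'; have := inj m.+1 _ _ neq_fb'.
      have := motion_step P_motion m f; move: b'_m; rewrite /lmove.
      by clear -lt_maf Pmb'; lia.
    have [v [v_in v_r _ _]] := crossing (leq0n m.+1) lt_fb' lt_b'f1.
    have [eq_uv|lt_vu] : u = v \/ v < u by clear -v_in le_mu; lia.
      by rewrite -eq_uv lmove_not_rmove in v_r.
    by rewrite (rmove_lmove P_motion v_r u_l lt_vu) in Mf.
  (* Conversely, an element passed by [a] moves left and is then left of [b']. At time [s] it is
     right of [b'], since it stays on its side of the gap and [p.+1] is taken. So it moves right
     later. *)
  case/andP=> lt_af lt_mfa; have [u [u_in u_r u_l _]] := crossing le_tm lt_af lt_mfa.
  have neq_fa : f != a by apply: contraTneq lt_af => ->; rewrite ltnn.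
  have lt_fa : f < a.
    rewrite ltnNge leq_eqVlt; apply/negP=> /orP[/eqP/ord_inj eq_fa|lt_af'].
      by rewrite eq_fa eqxx in neq_fa.
    by have := motion_mono_le le_tm lt_af' lt_af; clear -lt_mfa; lia.
  have neq_fb' : f != b' by apply: contraTneq lt_mfa => ->; clear -Pmb'; lia.
  have lt_sf : P s b' < P s f.
    have := closed s f (leqnn s); have := closed t f (ltnW lt_ts).
    have := inj s _ _ neq_fb'; have := Pta t (leqnn t).
    by clear -lt_af lt_ts Pb'; lia.
  have lt_mfb' : P m f < P m b' by clear -lt_mfa Pmb'; lia.
  have [v [v_in v_r v_l _]] : exists v, [/\ m <= v < s, rmove P v f, lmove P v b' &
      P v b' = (P v f).+1 :> nat].
    by apply: crossing => //; clear -m_in; lia.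
  have Mf : M f = [:: L; R].
    by apply: (lmove_rmove P_motion u_l v_r); clear -u_in v_in; lia.
  rewrite Mf eqxx lt_fa andbT /= -andbA; apply/and3P; split.
  - have := closed t f (ltnW lt_ts); have := inj 0 _ _ neq_fa.
    have := Pta t (leqnn t); clear -lt_af lt_ts Pa; lia.
  - have lt_b'f : b' < f.
      rewrite ltnNge leq_eqVlt; apply/negP=> /orP[/eqP/ord_inj eq_fb|lt_fb'].
        by rewrite eq_fb eqxx in neq_fb'.
      have le_ms : m <= s by clear -m_in; lia.
      by have := motion_mono_le le_ms lt_fb' lt_mfb'; clear -lt_sf; lia.
    rewrite ltnNge leq_eqVlt; apply/negP=> /orP[/eqP/ord_inj/(motion_inj P_motion) eq_fb|lt_b'f0].
      by rewrite eq_fb eqxx in neq_fb'.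
    by have := motion_mono_le (leq0n m) lt_b'f lt_b'f0; clear -lt_mfb'; lia.
  (* If [f] were smaller than [a'], it would still have to cross [a'] from time [s] on, moving left
     after having moved right. *)
  - rewrite ltnNge leq_eqVlt; apply/negP=> /orP[/eqP/ord_inj eq_fa'|lt_fa'].
      by rewrite eq_fa' in lt_sf; clear -lt_sf Pa' Pb'; lia.
    have lt_a'f : P s a' < P s f by clear -lt_sf Pa' Pb'; lia.
    have [w [w_in _ w_l _]] := final_crossing lt_fa' lt_a'f.
    have lt_vw : v < w by clear -v_in w_in; lia.
    by rewrite (rmove_lmove P_motion v_r w_l lt_vw) in Mf.
(* The sides of the triangle give [P m a = p.+1 + (m - t)] and [P m b' = p.+1 + (s - m)]. These
   positions are consecutive, so [s = t.+1 + 2 * (m - t)]. *)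
rewrite card_crossed //; clear -m_in le_tm Pma Pmb Pmb' Pb'; lia.
Qed.

End MotionTheory.

(** * Reflection, delay and insertion of a swap *)

Definition flip (l : letter) : letter := if l is L then R else L.

Definition mirror_marking n (M : marking n) : marking n :=
  fun x => map flip (M (rev_ord x)).

(** Positions and elements are reversed together, so the final permutation is still the identity and
    inversions remain inversions, while left and right are exchanged. *)
Definition mirror n (P : nat -> 'I_n -> 'I_n) t x := rev_ord (P t (rev_ord x)).

Lemma rmove_mirror n (P : nat -> 'I_n -> 'I_n) t x :
  rmove (mirror P) t x = lmove P t (rev_ord x).
Proof.
rewrite /rmove /lmove /mirror /=; have := ltn_ord (P t (rev_ord x)).
by have := ltn_ord (P t.+1 (rev_ord x)); lia.
Qed.

Lemma lmove_mirror n (P : nat -> 'I_n -> 'I_n) t x :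
  lmove (mirror P) t x = rmove P t (rev_ord x).
Proof.
rewrite /rmove /lmove /mirror /=; have := ltn_ord (P t (rev_ord x)).
by have := ltn_ord (P t.+1 (rev_ord x)); lia.
Qed.

Lemma motion_mirror n (M : marking n) P :
  motion M P -> motion (mirror_marking M) (mirror P).
Proof.
case=> inj step mono rconv lconv lr rl [N fin].
split.
- by move=> t x y /rev_ord_inj/inj/rev_ord_inj.
- move=> t x; have := step t (rev_ord x); rewrite /mirror /=.
  have := ltn_ord (P t (rev_ord x)); have := ltn_ord (P t.+1 (rev_ord x)); lia.
- move=> t x y lt_xy; have := mono t (rev_ord y) (rev_ord x).
  rewrite /mirror /=; have := ltn_ord (P t (rev_ord x)).
  have := ltn_ord (P t.+1 (rev_ord x)); have := ltn_ord (P t (rev_ord y)).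
  have := ltn_ord (P t.+1 (rev_ord y)); have := ltn_ord x; have := ltn_ord y.
  lia.
- by move=> s t u x; rewrite !rmove_mirror; apply: lconv.
- by move=> s t u x; rewrite !lmove_mirror; apply: rconv.
- by move=> s u x; rewrite rmove_mirror lmove_mirror /mirror_marking => ? ? ?; rewrite (rl s u).
- by move=> s u x; rewrite rmove_mirror lmove_mirror /mirror_marking => ? ? ?; rewrite (lr s u).
- by exists N => t le_Nt x; rewrite /mirror fin ?rev_ordK.
Qed.

(** This is [right_gap_time] for the mirrored motion, whose gap is [n - p.+2]; there [b] plays the
    role of [a], [b'] that of [a'], and [a'] that of [b']. *)
Lemma left_gap_time n (M : marking n) P (P_motion : motion M P) p s t (b a' b' : 'I_n) :
  (forall u x, u <= s -> (P u x <= p) = (P 0 x <= p)) ->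
  P 0 b = p :> nat ->
  (forall u, u < t -> ~~ rmove P u b /\ ~~ lmove P u b) -> lmove P t b ->
  P s a' = p :> nat -> rmove P s a' -> P s b' = p.+1 :> nat -> lmove P s b' ->
  [/\ b < a', P 0 a' < P 0 b &
      s = t.+1 + 2 * #|[set f | [&& M f == [:: R; L], P 0 a' < P 0 f < P 0 b
                                 & b < f < b']]|].
Proof.
move=> closed Pb b_static b_t Pa' a'_s Pb' b'_s.
have bd u x := ltn_ord (P u x).
have Ppn : p.+1 < n by rewrite -Pb'.
have [||||||||] := @right_gap_time n _ _ (motion_mirror P_motion) (n - p.+2) s t
    (rev_ord b) (rev_ord b') (rev_ord a').
- move=> u x le_us; have := closed u (rev_ord x) le_us; rewrite /mirror /=.
  have := bd u (rev_ord x); have := bd 0 (rev_ord x); lia.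
- by rewrite /mirror /= rev_ordK Pb; lia.
- by move=> u /b_static[]; rewrite rmove_mirror lmove_mirror rev_ordK.
- by rewrite rmove_mirror rev_ordK.
- by rewrite /mirror /= rev_ordK Pb'.
- by rewrite rmove_mirror rev_ordK.
- by rewrite /mirror /= rev_ordK Pa'; lia.
- by rewrite lmove_mirror rev_ordK.
rewrite /mirror /= !rev_ordK => lt_ba' lt_Pa'b ->.
have ba := ltn_ord b; have ba' := ltn_ord a'; have bb' := ltn_ord b'.
have bPa' := bd 0 a'; have bPb := bd 0 b.
split; [lia | lia |].
congr (_ + 2 * _); rewrite -[RHS](on_card_preimset (f := @rev_ord n)); last first.
  by apply: onW_bij; exists (@rev_ord n); apply: rev_ordK.
apply: eq_card => f; rewrite !inE /mirror_marking.
have bf := ltn_ord f; have bPf := bd 0 (rev_ord f).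
congr [&& _, _ & _]; last by rewrite /=; lia.
  by case: (M _) => [|[] [|[] []]].
by lia.
Qed.

Section Delay.
Variables (n : nat) (M : marking n) (P : nat -> 'I_n -> 'I_n).
Hypothesis P_motion : motion M P.
Variables p k1 k2 : nat.
Hypothesis closed : forall u x, (P u x <= p) = (P 0 x <= p).

Definition delay_of x := if P 0 x <= p then k1 else k2.
(** The subtraction is truncated: each element waits at its initial position until its delay is
    over. *)
Definition delay t x := P (t - delay_of x) x.

Lemma rmove_delay t x :
  rmove delay t x = (delay_of x <= t) && rmove P (t - delay_of x) x.
Proof.
rewrite /rmove /delay; case: leqP => [le|lt]; first by rewrite subSn.
have [-> ->] : t - delay_of x = 0 /\ t.+1 - delay_of x = 0 by lia.
by lia.
Qed.

Lemma lmove_delay t x :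
  lmove delay t x = (delay_of x <= t) && lmove P (t - delay_of x) x.
Proof.
rewrite /lmove /delay; case: leqP => [le|lt]; first by rewrite subSn.
have [-> ->] : t - delay_of x = 0 /\ t.+1 - delay_of x = 0 by lia.
by lia.
Qed.

Lemma delay0 : delay 0 =1 P 0. Proof. by []. Qed.

Lemma delay_sides t x : (delay t x <= p) = (P 0 x <= p).
Proof. exact: closed. Qed.

(** Elements on the same side share their delay, so they behave as in [P] at a common time. Elements
    on different sides keep their order, because no path passes the gap. *)
Lemma motion_delay : motion M delay.
Proof.
case: P_motion => inj step mono rconv lconv lr rl [N fin].
have same x y t : delay t x <= p = (delay t y <= p) -> delay_of x = delay_of y.
  by rewrite !delay_sides /delay_of => ->.
split.
- move=> t x y eq_xy; have := same x y t; rewrite eq_xy => /(_ erefl) eq_d.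
  by move: eq_xy; rewrite /delay eq_d => /inj.
- move=> t x; rewrite /delay; case: (leqP (delay_of x) t) => [le|lt].
    by rewrite subSn //; apply: step.
  have [-> ->] : t - delay_of x = 0 /\ t.+1 - delay_of x = 0 by lia.
  by lia.
- move=> t x y lt_xy lt_P; have := delay_sides t.+1 x; have := delay_sides t.+1 y.
  have := delay_sides t x; have := delay_sides t y.
  have [eq_s|neq_s] := eqVneq (delay t x <= p) (delay t y <= p); last by lia.
  move=> _ _ _ _; move: lt_P; rewrite /delay (same x y t) //.
  case: (leqP (delay_of y) t) => [le|lt]; first by rewrite subSn //; apply: mono.
  by have [-> ->] : t - delay_of y = 0 /\ t.+1 - delay_of y = 0 by lia.
- move=> s t u x; rewrite !rmove_delay => /andP[? s_r] /andP[? u_r] t_in.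
  by apply/andP; split; [lia | apply: rconv s_r u_r _; lia].
- move=> s t u x; rewrite !lmove_delay => /andP[? s_r] /andP[? u_r] t_in.
  by apply/andP; split; [lia | apply: lconv s_r u_r _; lia].
- move=> s u x; rewrite rmove_delay lmove_delay => /andP[? s_r] /andP[? u_r] lt_su.
  by apply: lr s_r u_r _; lia.
- move=> s u x; rewrite rmove_delay lmove_delay => /andP[? s_r] /andP[? u_r] lt_su.
  by apply: rl s_r u_r _; lia.
- exists (N + k1 + k2) => t le_t x; apply: fin.
  by rewrite /delay_of; case: ifP; lia.
Qed.

End Delay.

(** * Putting one more swap on top of a motion *)

Section Insert.
Variables (n : nat) (M M' : marking n) (P : nat -> 'I_n -> 'I_n).
Hypothesis P_motion : motion M' P.
Variables (p q a b : 'I_n) (t : nat).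
Hypotheses (pq : q = p.+1 :> nat) (lt_ba : b < a) (t_gt0 : 0 < t).
Hypothesis Pa : forall u, u <= t -> P u a = q.
Hypothesis Pb : forall u, u <= t -> P u b = p.
Hypothesis a_first : forall u, rmove P u a -> rmove P t a.
Hypothesis b_first : forall u, lmove P u b -> lmove P t b.
Hypothesis eq_M : forall x : 'I_n, x != a -> x != b -> M x = M' x.
Hypothesis a_nLR : M' a <> [:: L; R].
Hypothesis b_nRL : M' b <> [:: R; L].
Hypothesis a_RL : forall u, lmove P u a -> M a = [:: R; L].
Hypothesis b_LR : forall u, rmove P u b -> M b = [:: L; R].

(* The elements at positions [p] and [q] before time [t] are now exchanged by
   the step from [t.-1] to [t]. *)
Definition insert_swap (u : nat) (x : 'I_n) : 'I_n := if u < t then tperm p q (P u x) else P u x.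

Let Q := insert_swap.

Lemma insert_swap_a u : u < t -> Q u a = p.
Proof. by move=> lt_ut; rewrite /Q /insert_swap lt_ut Pa ?tpermR // ltnW. Qed.

Lemma insert_swap_b u : u < t -> Q u b = q.
Proof. by move=> lt_ut; rewrite /Q /insert_swap lt_ut Pb ?tpermL // ltnW. Qed.

Lemma insert_swap_late u x : t <= u -> Q u x = P u x.
Proof. by rewrite /Q /insert_swap ltnNge => ->. Qed.

Lemma insert_swap_other u (x : 'I_n) : x != a -> x != b -> Q u x = P u x.
Proof.
move=> neq_a neq_b; rewrite /Q /insert_swap; case: ltnP => // /ltnW le_ut.
rewrite tpermD //.
  by rewrite -(Pb le_ut) (inj_eq (@motion_inj _ _ _ P_motion u)) eq_sym.
by rewrite -(Pa le_ut) (inj_eq (@motion_inj _ _ _ P_motion u)) eq_sym.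
Qed.

Let late u : (u.+1 < t) || (u.+1 == t) || (t <= u).
Proof. by lia. Qed.

Let neq_ab : a != b.
Proof. by apply: contraTneq lt_ba => ->; rewrite ltnn. Qed.

Lemma rmove_insert_a u : rmove Q u a = (u.+1 == t) || rmove P u a.
Proof.
have [/orP[lt_u|/eqP eq_u]|le_tu] := orP (late u).
- rewrite /rmove !insert_swap_a ?Pa; lia.
- rewrite /rmove (@insert_swap_a u) ?(@insert_swap_late u.+1) ?Pa; lia.
- by rewrite /rmove !insert_swap_late //; lia.
Qed.

Lemma lmove_insert_a u : lmove Q u a = lmove P u a.
Proof.
have [/orP[lt_u|/eqP eq_u]|le_tu] := orP (late u).
- rewrite /lmove !insert_swap_a ?Pa; lia.
- rewrite /lmove (@insert_swap_a u) ?(@insert_swap_late u.+1) ?Pa; lia.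
- by rewrite /lmove !insert_swap_late //; lia.
Qed.

Lemma lmove_insert_b u : lmove Q u b = (u.+1 == t) || lmove P u b.
Proof.
have [/orP[lt_u|/eqP eq_u]|le_tu] := orP (late u).
- rewrite /lmove !insert_swap_b ?Pb; lia.
- rewrite /lmove (@insert_swap_b u) ?(@insert_swap_late u.+1) ?Pb; lia.
- by rewrite /lmove !insert_swap_late //; lia.
Qed.

Lemma rmove_insert_b u : rmove Q u b = rmove P u b.
Proof.
have [/orP[lt_u|/eqP eq_u]|le_tu] := orP (late u).
- rewrite /rmove !insert_swap_b ?Pb; lia.
- rewrite /rmove (@insert_swap_b u) ?(@insert_swap_late u.+1) ?Pb; lia.
- by rewrite /rmove !insert_swap_late //; lia.
Qed.

Let early_a u : u < t -> rmove P u a = false.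
Proof. by move=> lt_ut; rewrite /rmove !Pa //; lia. Qed.

Let early_al u : u < t -> lmove P u a = false.
Proof. by move=> lt_ut; rewrite /lmove !Pa //; lia. Qed.

Let early_b u : u < t -> lmove P u b = false.
Proof. by move=> lt_ut; rewrite /lmove !Pb //; lia. Qed.

Let early_br u : u < t -> rmove P u b = false.
Proof. by move=> lt_ut; rewrite /rmove !Pb //; lia. Qed.

Let others_away u (z : 'I_n) : u <= t -> z != a -> z != b ->
  (P u z != p :> nat) && (P u z != q :> nat).
Proof.
move=> le_ut za zb; rewrite -(Pa le_ut) -(Pb le_ut) !val_eqE.
by rewrite !(inj_eq (@motion_inj _ _ _ P_motion u)) za zb.
Qed.

(** Exchanging two neighbours affects the order of no other pair. Together with [insert_swap_gt],
    this carries the monotonicity of [P] over to the new motion. *)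
Lemma insert_swap_lt u (x y : 'I_n) : u < t -> x < y -> Q u x < Q u y ->
  P u x < P u y /\ ~~ ((x == b) && (y == a)).
Proof.
move=> lt_ut lt_xy; have le_ut := ltnW lt_ut; have fx := others_away (z := x) le_ut.
have fy := others_away (z := y) le_ut.
have [eq_xa|xa] := eqVneq x a.
  have ya : y != a by apply: contraTneq lt_xy => ->; rewrite eq_xa ltnn.
  have yb : y != b by apply: contraTneq lt_xy => ->; rewrite eq_xa; lia.
  rewrite eq_xa insert_swap_a // insert_swap_other // Pa // (negPf neq_ab).
  by have := fy ya yb; lia.
have [eq_xb|xb] := eqVneq x b.
  have yb : y != b by apply: contraTneq lt_xy => ->; rewrite eq_xb ltnn.
  rewrite eq_xb insert_swap_b //; have [->|ya] := eqVneq y a.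
    by rewrite insert_swap_a //; lia.
  by rewrite insert_swap_other // Pb //; have := fy ya yb; lia.
rewrite insert_swap_other //; have := fx xa xb.
have [->|ya] := eqVneq y a; first by rewrite insert_swap_a // Pa //; lia.
have [->|yb] := eqVneq y b; first by rewrite insert_swap_b // Pb //; lia.
by rewrite insert_swap_other.
Qed.

Lemma insert_swap_gt u (x y : 'I_n) : u < t -> x < y -> P u x < P u y ->
  ~~ ((x == b) && (y == a)) -> Q u x < Q u y.
Proof.
move=> lt_ut lt_xy; have le_ut := ltnW lt_ut; have fx := others_away (z := x) le_ut.
have fy := others_away (z := y) le_ut.
have [eq_xa|xa] := eqVneq x a.
  have ya : y != a by apply: contraTneq lt_xy => ->; rewrite eq_xa ltnn.
  have yb : y != b by apply: contraTneq lt_xy => ->; rewrite eq_xa; lia.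
  rewrite eq_xa insert_swap_a // insert_swap_other // Pa //.
  by have := fy ya yb; lia.
have [eq_xb|xb] := eqVneq x b.
  have yb : y != b by apply: contraTneq lt_xy => ->; rewrite eq_xb ltnn.
  rewrite eq_xb insert_swap_b //; have [->|ya] := eqVneq y a; first by [].
  by rewrite insert_swap_other // Pb //; have := fy ya yb; lia.
rewrite (insert_swap_other _ xa xb); have := fx xa xb.
have [->|ya] := eqVneq y a; first by rewrite insert_swap_a // Pa //; lia.
have [->|yb] := eqVneq y b; first by rewrite insert_swap_b // Pb //; lia.
by rewrite insert_swap_other.
Qed.

(** Only [a] and [b] gain a move. The new right move of [a] ends at time [t], when its other right
    moves, if any, begin, so they form one run. It precedes every left move of [a], which is why
    such a left move has to come with [M a = [:: R; L]]. The same holds for [b] with the sides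
    exchanged. *)
Lemma motion_insert : motion M insert_swap.
Proof.
case: (P_motion) => inj step mono rconv lconv lr rl [N fin]; rewrite -/Q.
have Q_inj u : injective (Q u).
  by move=> x y; rewrite /Q /insert_swap; case: ifP => _; [move/perm_inj/inj | move/inj].
have rQ u x : x != a -> x != b -> rmove Q u x = rmove P u x.
  by move=> xa xb; rewrite /rmove !(insert_swap_other _ xa xb).
have lQ u x : x != a -> x != b -> lmove Q u x = lmove P u x.
  by move=> xa xb; rewrite /lmove !(insert_swap_other _ xa xb).
split=> //.
- move=> u x; have [->|xa] := eqVneq x a.
    have [/orP[lt_u|/eqP eq_u]|le_tu] := orP (late u).
    + by rewrite !insert_swap_a; lia.
    + rewrite (@insert_swap_a u) ?(@insert_swap_late u.+1) ?Pa; lia.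
    + by rewrite !insert_swap_late //; lia.
  have [->|xb] := eqVneq x b.
    have [/orP[lt_u|/eqP eq_u]|le_tu] := orP (late u).
    + by rewrite !insert_swap_b; lia.
    + rewrite (@insert_swap_b u) ?(@insert_swap_late u.+1) ?Pb; lia.
    + by rewrite !insert_swap_late //; lia.
  by rewrite !(insert_swap_other _ xa xb).
- move=> u x y lt_xy lt_Q.
  have [le_tu|lt_ut] := leqP t u.
    by move: lt_Q; rewrite !insert_swap_late; [exact: mono | lia..].
  have [lt_P neq_yx] := insert_swap_lt lt_ut lt_xy lt_Q.
  have {}lt_P := mono u _ _ lt_xy lt_P.
  have [le_t|lt_ut1] := leqP t u.+1; first by rewrite !insert_swap_late.
  exact: insert_swap_gt.
- move=> s v u x; have [->|xa] := eqVneq x a.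
    rewrite !rmove_insert_a => s_r u_r v_in; case: eqP => //= neq_vt.
    have lt_tv : t <= v.
      case/orP: s_r => [/eqP eq_s|s_r]; first by lia.
      by have := early_a (u := s); rewrite s_r => early; case: (leqP t s) => [|/early//]; lia.
    have u_r' : rmove P u a by case/orP: u_r => // /eqP; lia.
    by apply: rconv (a_first u_r') u_r' _; lia.
  have [->|xb] := eqVneq x b; first by rewrite !rmove_insert_b; apply: rconv.
  by rewrite !rQ //; apply: rconv.
- move=> s v u x; have [->|xa] := eqVneq x a; first by rewrite !lmove_insert_a; apply: lconv.
  have [->|xb] := eqVneq x b.
    rewrite !lmove_insert_b => s_r u_r v_in; case: eqP => //= neq_vt.
    have lt_tv : t <= v.
      case/orP: s_r => [/eqP eq_s|s_r]; first by lia.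
      by have := early_b (u := s); rewrite s_r => early; case: (leqP t s) => [|/early//]; lia.
    have u_r' : lmove P u b by case/orP: u_r => // /eqP; lia.
    by apply: lconv (b_first u_r') u_r' _; lia.
  by rewrite !lQ //; apply: lconv.
- move=> s u x; have [->|xa] := eqVneq x a.
    rewrite lmove_insert_a rmove_insert_a => s_l /orP[/eqP eq_u|u_r] lt_su.
      by rewrite early_al // in s_l; lia.
    by case: a_nLR; apply: lr s_l u_r lt_su.
  have [->|xb] := eqVneq x b.
    by rewrite lmove_insert_b rmove_insert_b => _ /b_LR.
  by rewrite lQ // rQ // eq_M //; apply: lr.
- move=> s u x; have [->|xa] := eqVneq x a.
    by rewrite lmove_insert_a => _ /a_RL.
  have [->|xb] := eqVneq x b.
    rewrite lmove_insert_b rmove_insert_b => s_r /orP[/eqP eq_u|u_l] lt_su.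
      by rewrite early_br // in s_r; lia.
    by case: b_nRL; apply: rl s_r u_l lt_su.
  by rewrite lQ // rQ // eq_M //; apply: rl.
- exists (maxn N t) => u; rewrite geq_max => /andP[le_N le_t] x.
  by rewrite insert_swap_late // fin.
Qed.

End Insert.

(** * First moves and the first use of a gap *)

Section MotionEvents.
Variables (n : nat) (M : marking n) (P : nat -> 'I_n -> 'I_n).
Hypothesis P_motion : motion M P.

(** The first right move is the first move of any kind: a left move before it would make [M x] equal
    to [[:: L; R]]. *)
Lemma first_rmove x : M x <> [:: L; R] -> (exists u, rmove P u x) ->
  exists2 t, rmove P t x & forall u, u < t -> ~~ rmove P u x /\ ~~ lmove P u x.
Proof.
move=> Mx ex_u; case: (ex_minnP ex_u) => t t_r t_min; exists t => // u lt_ut.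
split; first by apply/negP=> /t_min; lia.
by apply/negP=> u_l; case: Mx; apply: (lmove_rmove P_motion u_l t_r).
Qed.

Lemma first_lmove x : M x <> [:: R; L] -> (exists u, lmove P u x) ->
  exists2 t, lmove P t x & forall u, u < t -> ~~ rmove P u x /\ ~~ lmove P u x.
Proof.
move=> Mx ex_u; case: (ex_minnP ex_u) => t t_r t_min; exists t => // u lt_ut.
split; last by apply/negP=> /t_min; lia.
by apply/negP=> u_r; case: Mx; apply: (rmove_lmove P_motion u_r t_r).
Qed.

(** Nothing changes after the motion has settled, so finitely many times have to be searched. At the
    step before the first time when an element is on the wrong side, that element and the one it
    exchanges with are the required pair. *)
Lemma gap_closed_or_first_use p :
  (forall u x, (P u x <= p) = (P 0 x <= p)) \/
  exists s a b, [/\ forall u x, u <= s -> (P u x <= p) = (P 0 x <= p),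
    P s a = p :> nat /\ rmove P s a & P s b = p.+1 :> nat /\ lmove P s b].
Proof.
have [N PN] := motion_final P_motion.
pose used u := [exists x, (P u x <= p) != (P 0 x <= p)].
have [ex_u|] := boolP [exists u : 'I_N.+1, used u]; last first.
  rewrite negb_exists => /forallP closed; left=> u x.
  have closed_at (v : 'I_N.+1) : (P v x <= p) = (P 0 x <= p).
    by have := closed v; rewrite negb_exists => /forallP/(_ x)/negbNE/eqP.
  have [le_uN|/ltnW le_Nu] := leqP u N; first exact: (closed_at (Ordinal (_ : u < N.+1))).
  by rewrite -(closed_at ord_max) /= !PN.
right; have {}ex_u : exists u, used u by case/existsP: ex_u => u; exists u.
case: (ex_minnP ex_u) => [[|s]] /existsP[x x_used] s_min; first by rewrite eqxx in x_used.
have closed u y : u <= s -> (P u y <= p) = (P 0 y <= p).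
  move=> le_us; apply: contraTeq le_us => y_used; rewrite -ltnNge.
  by apply: s_min; apply/existsP; exists y.
have := motion_step P_motion s x; rewrite -(closed s x) // in x_used => step.
have [le_x|lt_x] := leqP (P s x) p.
  have x_s : rmove P s x by rewrite /rmove; clear -x_used step le_x; lia.
  have [y [_ _ y_s Py]] := rmove_inversion P_motion x_s.
  by exists s, x, y; split=> //; split=> //; clear -x_used step le_x Py; lia.
have x_s : lmove P s x by rewrite /lmove; clear -x_used step lt_x; lia.
have [y [_ _ y_s Py]] := lmove_inversion P_motion x_s.
by exists s, y, x; split=> //; split=> //; clear -x_used step lt_x Py; lia.
Qed.

End MotionEvents.

(** * Markings and the first swap *)

Lemma starts_with_R (s : seq letter) :
  uniq s -> ohead s = Some R -> s = [:: R] \/ s = [:: R; L].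
Proof. by case: s => [|[] [|[] [|[] s]]]; rewrite /= ?inE ?andbF //; auto. Qed.

Lemma starts_with_L (s : seq letter) :
  uniq s -> ohead s = Some L -> s = [:: L] \/ s = [:: L; R].
Proof. by case: s => [|[] [|[] [|[] s]]]; rewrite /= ?inE ?andbF //; auto. Qed.

(** A string over two letters without repetition is determined by its letters up to their order, and
    the order is free exactly for switchbacks. *)
Lemma marking_forP n (pi : 'S_n) (M : marking n) :
  marking_for pi M <->
  forall i, [/\ (L \in M i) = left_elt pi i, (R \in M i) = right_elt pi i & uniq (M i)].
Proof.
split=> M_pi i; have := M_pi i; rewrite /left_straight /right_straight /switchback.
  by case: (left_elt pi i); case: (right_elt pi i) => -[//= H1 H2 H3 H4];
    [case: H3 => // -> | rewrite H1 | rewrite H2 | rewrite H4].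
case: (M i) => [|[] [|[] [|[] s]]] [] <- <-; rewrite /= ?inE ?andbF //= => _; split=> // _; auto.
Qed.

Lemma pos_inj n (pi : 'S_n) : injective (pos pi).
Proof. exact: perm_inj. Qed.

Lemma inversion_right_elt n (pi : 'S_n) a b : inversion pi a b -> right_elt pi a.
Proof. by move=> ab; apply/existsP; exists b. Qed.

Lemma inversion_left_elt n (pi : 'S_n) a b : inversion pi a b -> left_elt pi b.
Proof. by move=> ab; apply/existsP; exists a. Qed.

Lemma no_inversion n (pi : 'S_n) : (forall x y, ~~ inversion pi x y) -> pos pi =1 id.
Proof.
move=> no_inv x; apply: ord_inj.
have lt_pos (y z : 'I_n) : y < z -> pos pi y < pos pi z.
  move=> lt_yz; have := no_inv z y; rewrite /inversion lt_yz /= -leqNgt leq_eqVlt.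
  by case/orP=> // /eqP/ord_inj/pos_inj eq_yz; rewrite eq_yz ltnn in lt_yz.
rewrite -[LHS](@card_below n (pos pi) (pos pi x)) ?(ltnW (ltn_ord _)) //; last exact: pos_inj.
rewrite -[RHS](@card_below n id x) ?(ltnW (ltn_ord _)) //.
apply: eq_card => y; rewrite !inE; apply/idP/idP; last exact: lt_pos.
by rewrite !ltnNge; apply: contra; rewrite leq_eqVlt => /orP[/eqP/ord_inj->//|/lt_pos/ltnW].
Qed.

Lemma static_motion n (M : marking n) : motion M (fun _ => id).
Proof.
have no_r t x : rmove (fun _ => @id 'I_n) t x = false by rewrite /rmove; lia.
have no_l t x : lmove (fun _ => @id 'I_n) t x = false by rewrite /lmove; lia.
split=> //.
- by move=> t x y.
- by move=> t x; rewrite leqnSn.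
- by move=> s u x; rewrite no_l.
- by move=> s u x; rewrite no_r.
- by exists 0.
Qed.

(** The last left element is not right, so some string starts with [L]; let [b] be the first such
    element. Some [i] larger than [b] precedes it. If the string of the predecessor [a] were empty,
    then [a] would differ from [i] and be in no inversion, yet either [(i, a)] or [(a, b)] is
    one. *)
Lemma exists_ready_pair n (pi : 'S_n) (M : marking n) x y :
  marking_for pi M -> inversion pi x y ->
  exists a b, [/\ immediately_before pi a b, ohead (M a) = Some R & ohead (M b) = Some L].
Proof.
move=> /marking_forP M_pi inv_xy.
pose startsL z := ohead (M z) == Some L.
have [j j_left j_last] : exists2 j, left_elt pi j &
    forall k, left_elt pi k -> pos pi k <= pos pi j.
  have y_left := inversion_left_elt inv_xy.
  by case: (arg_maxnP (fun k => pos pi k : nat) y_left) => j; exists j.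
have j_L : startsL j.
  have [lj rj uj] := M_pi j.
  have nR : R \notin M j.
    rewrite rj; apply/existsP=> -[k inv_jk].
    have := j_last k (inversion_left_elt inv_jk).
    by case/andP: inv_jk => _; rewrite /before ltnNge => /negP.
  by rewrite /startsL; move: nR; rewrite -lj in j_left; case: (M j) j_left => [|[]].
case: (arg_minnP (fun k => pos pi k : nat) j_L) => b b_L b_first.
have [lb rb ub] := M_pi b.
have /existsP[i /andP[lt_bi ib]] : left_elt pi b.
  by rewrite -lb; case: (M b) (eqP b_L) => // l s [->]; rewrite inE eqxx.
rewrite /before in ib.
have lt_k : (pos pi b).-1 < n by apply: leq_ltn_trans (leq_pred _) (ltn_ord _).
pose a := pi (Ordinal lt_k).
have pos_a : pos pi a = (pos pi b).-1 :> nat by rewrite /pos permK.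
have a_nL : ~~ startsL a by apply/negP=> /b_first; clear -ib pos_a; lia.
exists a, b; split; [by apply/eqP; clear -ib pos_a; lia | | exact/eqP].
case Ma: (M a) a_nL => [|[] s]; rewrite /startsL Ma //= => _.
have [la ra _] := M_pi a; rewrite Ma /= in la ra.
have neq_ia : i != a.
  apply: contraTneq isT => eq_ia; have := inversion_right_elt (pi := pi) (a := i) (b := b).
  by rewrite /inversion /before lt_bi ib => /(_ isT); rewrite eq_ia -ra.
have lt_ia : pos pi i < pos pi a.
  have : pos pi i != pos pi a :> nat by rewrite val_eqE (inj_eq (@pos_inj _ pi)).
  by clear -ib pos_a; lia.
have := inversion_left_elt (pi := pi) (a := i) (b := a); rewrite -la /inversion /before lt_ia.
case: ltnP => [_ /(_ isT)//|le_ia _].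
have := inversion_right_elt (pi := pi) (a := a) (b := b); rewrite -ra /inversion /before.
have -> : pos pi a < pos pi b by clear -ib pos_a; lia.
by rewrite (leq_trans lt_bi le_ia) => /(_ isT).
Qed.

(** * The permutation and the marking after swapping a ready pair *)

Section SwapReadyPair.
Variables (n : nat) (pi : 'S_n) (M : marking n) (a b : 'I_n).
Hypothesis M_marking : marking_for pi M.
Hypothesis M_balanced : balanced pi M.
Hypothesis M_aligned : aligned pi M.
Hypothesis ab_adj : immediately_before pi a b.
Hypothesis Ma_R : ohead (M a) = Some R.
Hypothesis Mb_L : ohead (M b) = Some L.

Definition swap_pair : 'S_n := (tperm (pos pi a) (pos pi b) * pi)%g.

Definition swap_marking : marking n := fun x =>
  if x == a then (if right_elt swap_pair a then M a else behead (M a))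
  else if x == b then (if left_elt swap_pair b then M b else behead (M b))
  else M x.

Local Notation pi' := swap_pair.
Local Notation M' := swap_marking.

Lemma ready_inversion : inversion pi a b.
Proof. exact: M_aligned. Qed.

Lemma ready_lt : b < a.
Proof. by case/andP: ready_inversion. Qed.

Let pos_b : pos pi b = (pos pi a).+1 :> nat.
Proof. exact/eqP. Qed.

Let neq_ab : a != b.
Proof. by apply: contraTneq ready_lt => ->; rewrite ltnn. Qed.

Lemma pos_swap x : pos pi' x = tperm (pos pi a) (pos pi b) (pos pi x).
Proof. by rewrite /pos /swap_pair invMg permM tpermV. Qed.

Lemma pos_swap_a : pos pi' a = pos pi b.
Proof. by rewrite pos_swap tpermL. Qed.

Lemma pos_swap_b : pos pi' b = pos pi a.
Proof. by rewrite pos_swap tpermR. Qed.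

Lemma pos_swap_other x : x != a -> x != b -> pos pi' x = pos pi x.
Proof. by move=> xa xb; rewrite pos_swap tpermD // (inj_eq (@pos_inj _ pi)) eq_sym. Qed.

Let pos_far x : x != a -> x != b ->
  (pos pi x != pos pi a :> nat) && (pos pi x != (pos pi a).+1 :> nat).
Proof.
by move=> xa xb; rewrite -pos_b !val_eqE !(inj_eq (@pos_inj _ pi)) xa xb.
Qed.

Lemma before_swap x y : ~~ ((x == a) && (y == b)) -> ~~ ((x == b) && (y == a)) ->
  before pi' x y = before pi x y.
Proof.
rewrite /before.
have [->|xa] := eqVneq x a; have [->|ya] := eqVneq y a; rewrite /= ?ltnn //.
- have [->|yb] := eqVneq y b => //= _ _; rewrite pos_swap_a pos_swap_other //.
  by have := pos_far ya yb; lia.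
- rewrite andbT pos_swap_a => _ xb; rewrite pos_swap_other //.
  by have := pos_far xa xb; lia.
have [->|xb] := eqVneq x b; have [->|yb] := eqVneq y b; rewrite /= ?ltnn // => _ _.
- by rewrite pos_swap_b pos_swap_other //; have := pos_far ya yb; lia.
- by rewrite pos_swap_b pos_swap_other //; have := pos_far xa xb; lia.
by rewrite !pos_swap_other.
Qed.

Lemma before_swap_ab : before pi' a b = false.
Proof. by rewrite /before pos_swap_a pos_swap_b; lia. Qed.

Lemma inversion_swap x y : inversion pi' x y = inversion pi x y && ~~ ((x == a) && (y == b)).
Proof.
rewrite /inversion; have [xy|xy] := boolP ((x == a) && (y == b)).
  by case/andP: xy => /eqP -> /eqP ->; rewrite before_swap_ab !andbF.
rewrite andbT; have [yx|yx] := boolP ((x == b) && (y == a)).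
  by case/andP: yx => /eqP -> /eqP ->; rewrite ltnNge ltnW ?ready_lt.
by rewrite before_swap.
Qed.

Lemma right_elt_swap x : x != a -> right_elt pi' x = right_elt pi x.
Proof.
by move=> xa; apply: eq_existsb => y; rewrite inversion_swap (negPf xa) andbT.
Qed.

Lemma left_elt_swap x : x != b -> left_elt pi' x = left_elt pi x.
Proof.
by move=> xb; apply: eq_existsb => y; rewrite inversion_swap (negPf xb) andbF andbT.
Qed.

Let M_a : M a = [:: R] \/ M a = [:: R; L].
Proof.
by have /marking_forP/(_ a)[_ _ /starts_with_R] := M_marking; apply.
Qed.

Let M_b : M b = [:: L] \/ M b = [:: L; R].
Proof.
by have /marking_forP/(_ b)[_ _ /starts_with_L] := M_marking; apply.
Qed.

Lemma swap_marking_a : M' a = if right_elt pi' a then M a else behead (M a).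
Proof. by rewrite /swap_marking eqxx. Qed.

Lemma swap_marking_b : M' b = if left_elt pi' b then M b else behead (M b).
Proof. by rewrite /swap_marking eq_sym (negPf neq_ab) eqxx. Qed.

Lemma swap_marking_other x : x != a -> x != b -> M' x = M x.
Proof. by rewrite /swap_marking => /negPf -> /negPf ->. Qed.

(** Only [a] can cease to be right and only [b] can cease to be left. The letters concerned come
    first in their strings, so [behead] removes the correct ones. *)
Lemma marking_for_swap : marking_for pi' M'.
Proof.
have /marking_forP M_pi := M_marking; apply/marking_forP=> x.
have [la ra ua] := M_pi a; have [lb rb ub] := M_pi b.
have [->|xa] := eqVneq x a.
  rewrite swap_marking_a left_elt_swap // -la.
  by case: ifP => r; case: M_a => ->.
have [->|xb] := eqVneq x b.
  rewrite swap_marking_b right_elt_swap 1?eq_sym // -rb.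
  by case: ifP => r; case: M_b => ->.
by rewrite swap_marking_other // left_elt_swap // right_elt_swap.
Qed.

Lemma swap_marking_RL x : M' x = [:: R; L] -> M x = [:: R; L] /\ x != b.
Proof.
have [->|xb] := eqVneq x b.
  by rewrite swap_marking_b; case: ifP; case: M_b => ->.
have [->|xa] := eqVneq x a; last by rewrite swap_marking_other.
by rewrite swap_marking_a; case: ifP; case: M_a => ->.
Qed.

Lemma swap_marking_LR x : M' x = [:: L; R] -> M x = [:: L; R] /\ x != a.
Proof.
have [->|xa] := eqVneq x a.
  by rewrite swap_marking_a; case: ifP; case: M_a => ->.
have [->|xb] := eqVneq x b; last by rewrite swap_marking_other.
by rewrite swap_marking_b; case: ifP; case: M_b => ->.
Qed.

Lemma aligned_swap : aligned pi' M'.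
Proof.
have /marking_forP M_pi := M_marking; have lt_ba := ready_lt.
move=> x y; rewrite /immediately_before => /eqP xy Mx My; rewrite inversion_swap.
(* The new pair [(b, a)]: if [b] now starts with [R], it has a right inversion with some [j], and so
   has [a]. Hence [M' a] still starts with [R]. *)
have [eq_xb|xb] := eqVneq x b.
  have eq_ya : y = a.
    by apply: (@pos_inj _ pi'); apply: ord_inj; rewrite xy eq_xb pos_swap_a pos_swap_b.
  have [_ rb _] := M_pi b.
  have Mb : M b = [:: L; R].
    by move: Mx; rewrite eq_xb swap_marking_b; case: ifP; case: M_b => ->.
  have /existsP[j /andP[lt_jb bj]] : right_elt pi b by rewrite -rb Mb.
  suff right_a : right_elt pi' a.
    by move: My; rewrite eq_ya swap_marking_a right_a; case: M_a => ->.
  apply: (@inversion_right_elt _ _ _ j).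
  rewrite inversion_swap /inversion (ltn_trans lt_jb) //= -?(negPf neq_ab).
  move: bj; rewrite /before eqxx /= neq_ltn lt_jb andbT; lia.
have [eq_ya|ya] := eqVneq y a.
  case/eqP: xb; apply: (@pos_inj _ pi'); apply: ord_inj.
  by move: xy; rewrite eq_ya pos_swap_a pos_swap_b pos_b => -[].
(* The new pair [(a, y)] with [a < y]: [a] has kept a right inversion with some [i], which lies
   after [y], and [y] has a left one with some [j], which lies before [a]. So [(j, a, b, i)] is an
   irregular rec with the right switchback [y]. *)
have [eq_xa|xa] := eqVneq x a.
  have yb : y != b.
    by apply: contra_eq_neq xy => ->; rewrite eq_xa pos_swap_a pos_swap_b; lia.
  rewrite yb andbT eq_xa; apply: contraT => not_inv.
  have pos_y : pos pi y = (pos pi b).+1 :> nat.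
    by rewrite -[pos pi y]pos_swap_other // xy eq_xa pos_swap_a.
  have lt_ay : a < y.
    move: not_inv; rewrite /inversion /before pos_y pos_b.
    have : y != a :> nat by rewrite val_eqE.
    by clear; lia.
  have right_a : right_elt pi' a.
    by move: Mx; rewrite eq_xa swap_marking_a; case: ifP => //; case: M_a => ->.
  case/existsP: right_a => i; rewrite inversion_swap eqxx /= => /andP[/andP[lt_ia ai] ib].
  rewrite swap_marking_other // in My; have [ly ry uy] := M_pi y.
  have /existsP[j /andP[lt_yj jy]] : left_elt pi y.
    by rewrite -ly; case: (M y) My => // l s [->]; rewrite inE eqxx.
  have neq_iy : i != y by apply: contraTneq lt_ia => ->; clear -lt_ay; lia.
  have lt_yi : pos pi y < pos pi i.
    have := pos_far (x := i) _ ib; have := contra_neq (@pos_inj _ pi i y) neq_iy.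
    rewrite -val_eqE /= (_ : i != a); last by apply: contraTneq lt_ia => ->; rewrite ltnn.
    by move: ai; rewrite /before => + + /(_ isT); clear -pos_y pos_b; lia.
  have lt_ja : pos pi j < pos pi a.
    have jb : j != b by apply: contraTneq lt_yj => ->; clear -lt_ay lt_ba; lia.
    have ja : j != a by apply: contraTneq lt_yj => ->; clear -lt_ay; lia.
    by have := pos_far ja jb; move: jy; rewrite /before; clear -pos_y pos_b; lia.
  have My2 : M y = [:: L; R].
    have : R \in M y.
      rewrite ry; apply: (@inversion_right_elt _ _ _ i); rewrite /inversion /before.
      by clear -lt_ia lt_ay lt_yi; lia.
    by case: (starts_with_L uy My) => ->.
  have rec_jabi : rec pi j a b i.
    by rewrite /rec /before pos_b; clear -lt_ja lt_yi pos_y pos_b lt_ba lt_ia lt_yj lt_ay; lia.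
  have [_ []] := M_balanced rec_jabi; first by rewrite /regular; clear -lt_ay lt_yj; lia.
  move=> _ /setP/(_ y); rewrite !inE My2 eqxx /before /strictly_between /=.
  by clear -lt_ay lt_yj lt_yi pos_y; lia.
(* The mirror case [(x, b)] with [x < b]: [(i, a, b, j)] is an irregular rec with the left
   switchback [x]. *)
have [eq_yb|yb] := eqVneq y b.
  rewrite /= andbT eq_yb; apply: contraT => not_inv.
  have pos_x : pos pi a = (pos pi x).+1 :> nat.
    by rewrite -[pos pi x]pos_swap_other // -xy eq_yb pos_swap_b.
  have lt_xb : x < b.
    move: not_inv; rewrite /inversion /before pos_b pos_x.
    have : x != b :> nat by rewrite val_eqE.
    by clear; lia.
  have left_b : left_elt pi' b.
    by move: My; rewrite eq_yb swap_marking_b; case: ifP => //; case: M_b => ->.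
  case/existsP: left_b => i; rewrite inversion_swap eqxx andbT => /andP[/andP[lt_bi ib] ia].
  rewrite swap_marking_other // in Mx; have [lx rx ux] := M_pi x.
  have /existsP[j /andP[lt_jx xj]] : right_elt pi x.
    by rewrite -rx; case: (M x) Mx => // l s [->]; rewrite inE eqxx.
  have neq_ix : i != x by apply: contraTneq lt_bi => ->; clear -lt_xb; lia.
  have lt_ix : pos pi i < pos pi x.
    have := pos_far (x := i) ia; have := contra_neq (@pos_inj _ pi i x) neq_ix.
    rewrite -val_eqE /= (_ : i != b); last by apply: contraTneq lt_bi => ->; rewrite ltnn.
    by move: ib; rewrite /before => + + /(_ isT); clear -pos_x pos_b; lia.
  have lt_bj : pos pi b < pos pi j.
    have jb : j != b by apply: contraTneq lt_jx => ->; clear -lt_xb; lia.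
    have ja : j != a by apply: contraTneq lt_jx => ->; clear -lt_xb lt_ba; lia.
    by have := pos_far ja jb; move: xj; rewrite /before; clear -pos_x pos_b; lia.
  have Mx2 : M x = [:: R; L].
    have : L \in M x.
      rewrite lx; apply: (@inversion_left_elt _ _ i); rewrite /inversion /before.
      by clear -lt_bi lt_xb lt_ix; lia.
    by case: (starts_with_R ux Mx) => ->.
  have rec_iabj : rec pi i a b j.
    by rewrite /rec /before pos_b; clear -lt_bj lt_ix pos_x pos_b lt_ba lt_bi lt_xb lt_jx; lia.
  have [_ []] := M_balanced rec_iabj; first by rewrite /regular; clear -lt_jx lt_xb; lia.
  move=> /setP/(_ x); rewrite !inE Mx2 eqxx /before /strictly_between /=.
  by clear -lt_xb lt_jx lt_ix pos_x; lia.
rewrite /= andbT; rewrite !swap_marking_other // in Mx My.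
by apply: M_aligned => //; rewrite /immediately_before -!pos_swap_other // xy.
Qed.

(** Only [a] could drop out, by having its string shortened. But if it is a left switchback, the
    smaller of [y] and [z] gives it a right inversion that survives. *)
Lemma left_switchbacks_swap w x y z : rec pi w x y z ->
  left_switchbacks pi' M' w x y z = left_switchbacks pi M w x y z.
Proof.
case/and4P=> wx xy yz lt_rec; have lt_ba := ready_lt; apply/setP=> e; rewrite !inE.
have [->|eb] := eqVneq e b.
  have -> : (M' b == [:: R; L]) = false by apply/eqP => /swap_marking_RL[_]; rewrite eqxx.
  by case: M_b => ->.
have [->|ea] := eqVneq e a; last first.
  by rewrite swap_marking_other // !before_swap ?(negPf ea) ?(negPf eb) ?andbF.
have [a_btw|] := boolP (strictly_between y z a); last by rewrite !andbF.
have neq (u : 'I_n) : maxn y z < u -> (u != a) && (u != b).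
  move=> lt_u; apply/andP; split; apply: contraTneq lt_u => ->; move: a_btw;
  by rewrite /strictly_between; clear -lt_ba; lia.
have [wa wb] := andP (neq w ltac:(clear -lt_rec; lia)).
have [xa xb] := andP (neq x ltac:(clear -lt_rec; lia)).
rewrite !before_swap; try by rewrite ?(negPf wa) ?(negPf wb) ?(negPf xa) ?(negPf xb) ?andbF.
have [ax|] := boolP (before pi a x); last by rewrite !andbF.
rewrite swap_marking_a; suff -> : right_elt pi' a by [].
(* This element is not [b], because [x] lies between [a] and it, whereas [b] follows [a]
   immediately. *)
pose m := if y < z then y else z.
have am : inversion pi a m.
  move: a_btw ax xy yz; rewrite /inversion /before /strictly_between /m.
  by clear; case: (ltnP y z) => *; lia.
apply: (@inversion_right_elt _ _ _ m); rewrite inversion_swap am eqxx /=.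
apply: contraTneq xy => eq_m; rewrite /before.
move: ax; have := pos_far xa xb; rewrite /before => x_far lt_ax.
have : pos pi y <= pos pi m by rewrite /m; case: ifP => // _; exact: ltnW.
by rewrite eq_m; clear -pos_b x_far lt_ax; lia.
Qed.

Lemma right_switchbacks_swap w x y z : rec pi w x y z ->
  right_switchbacks pi' M' w x y z = right_switchbacks pi M w x y z.
Proof.
case/and4P=> wx xy yz lt_rec; have lt_ba := ready_lt; apply/setP=> e; rewrite !inE.
have [->|ea] := eqVneq e a.
  have -> : (M' a == [:: L; R]) = false by apply/eqP => /swap_marking_LR[_]; rewrite eqxx.
  by case: M_a => ->.
have [->|eb] := eqVneq e b; last first.
  by rewrite swap_marking_other // !before_swap ?(negPf ea) ?(negPf eb) ?andbF.
have [b_btw|] := boolP (strictly_between w x b); last by rewrite !andbF.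
have neq (u : 'I_n) : u < minn w x -> (u != a) && (u != b).
  move=> lt_u; apply/andP; split; apply: contraTneq lt_u => ->; move: b_btw;
  by rewrite /strictly_between; clear -lt_ba; lia.
have [ya yb] := andP (neq y ltac:(clear -lt_rec; lia)).
have [za zb] := andP (neq z ltac:(clear -lt_rec; lia)).
rewrite !before_swap; try by rewrite ?(negPf ya) ?(negPf yb) ?(negPf za) ?(negPf zb) ?andbF.
have [yb'|] := boolP (before pi y b); last by rewrite !andbF.
rewrite swap_marking_b; suff -> : left_elt pi' b by [].
pose m := if w < x then x else w.
have mb : inversion pi m b.
  move: b_btw yb' xy wx; rewrite /inversion /before /strictly_between /m.
  by clear; case: (ltnP w x) => *; lia.
apply: (@inversion_left_elt _ _ m); rewrite inversion_swap mb eqxx andbT.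
apply: contraTneq xy => eq_m; rewrite /before.
move: yb'; have := pos_far ya yb; rewrite /before => y_far lt_yb.
have : pos pi m <= pos pi x by rewrite /m; case: ifP => // _; exact: ltnW.
by rewrite eq_m; clear -pos_b y_far lt_yb; lia.
Qed.

(** A rec of the new permutation is one of the old with the same switchbacks, unless its first two
    or its last two elements are [b] and [a]. In that case exchanging them gives an irregular rec of
    [pi], which is empty, and then the new rec is empty too. *)
Lemma balanced_swap : balanced pi' M'.
Proof.
have lt_ba := ready_lt; move=> w x y z rec'.
case/and4P: (rec') => wx xy yz lt_rec.
have [/andP[/eqP eq_w /eqP eq_x]|not_wx] := boolP ((w == b) && (x == a)).
  subst w x.
  have neq (u : 'I_n) : u < b -> (u != a) && (u != b).
    move=> lt_u; apply/andP; split; apply: contraTneq lt_u => ->; rewrite ?ltnn //.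
    by clear -lt_ba; lia.
  have [ya yb] := andP (neq y ltac:(clear -lt_rec; lia));
  have [za zb] := andP (neq z ltac:(clear -lt_rec; lia)).
  have rec_ab : rec pi a b y z.
    move: xy yz; rewrite /rec /before pos_swap_a !(pos_swap_other ya, pos_swap_other za) //.
    by rewrite pos_b; clear -lt_rec; lia.
  have [_ [|_ right0]] := M_balanced rec_ab; first by rewrite /regular; clear -lt_ba; lia.
  rewrite /balanced_rec /empty_rec.
  have [-> ->] : left_switchbacks pi' M' b a y z = set0 /\
      right_switchbacks pi' M' b a y z = set0.
    split; apply/setP=> e; rewrite !inE; apply/negP.
      by case/and4P=> _; rewrite /before pos_swap_a pos_swap_b pos_b; clear; lia.
    case/and4P=> /eqP/swap_marking_LR[Me ea] ye ez e_btw; move/setP/(_ e): right0; rewrite !inE.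
    have eb : e != b.
      by apply: contraTneq e_btw => ->; rewrite /strictly_between; clear -lt_ba; lia.
    move: ye ez; rewrite !before_swap ?(negPf ea) ?(negPf eb) ?andbF //= => -> ->.
    by rewrite Me eqxx /=; move: e_btw; rewrite /strictly_between minnC maxnC => ->.
  by split=> // _; rewrite cards0.
have [/andP[/eqP eq_y /eqP eq_z]|not_yz] := boolP ((y == b) && (z == a)).
  subst y z.
  have neq (u : 'I_n) : a < u -> (u != a) && (u != b).
    move=> lt_u; apply/andP; split; apply: contraTneq lt_u => ->; rewrite ?ltnn //.
    by clear -lt_ba; lia.
  have [wa wb] := andP (neq w ltac:(clear -lt_rec; lia)).
  have [xa xb] := andP (neq x ltac:(clear -lt_rec; lia)).
  have rec_ab : rec pi w x a b.
    move: wx xy; rewrite /rec /before pos_swap_b !(pos_swap_other wa, pos_swap_other xa) //.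
    by rewrite pos_b; clear -lt_rec; lia.
  have [_ [|left0 _]] := M_balanced rec_ab; first by rewrite /regular; clear -lt_ba; lia.
  rewrite /balanced_rec /empty_rec.
  have [-> ->] : left_switchbacks pi' M' w x b a = set0 /\
      right_switchbacks pi' M' w x b a = set0.
    split; apply/setP=> e; rewrite !inE; apply/negP; last first.
      by case/and4P=> _; rewrite /before pos_swap_a pos_swap_b pos_b; clear; lia.
    case/and4P=> /eqP/swap_marking_RL[Me eb] we ex e_btw; move/setP/(_ e): left0; rewrite !inE.
    have ea : e != a.
      by apply: contraTneq e_btw => ->; rewrite /strictly_between; clear -lt_ba; lia.
    move: we ex; rewrite !before_swap ?(negPf ea) ?(negPf eb) ?andbF //= => -> ->.
    by rewrite Me eqxx /=; move: e_btw; rewrite /strictly_between minnC maxnC => ->.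
  by split=> // _; rewrite cards0.
have before_of (u v : 'I_n) : ~~ ((u == b) && (v == a)) -> before pi' u v -> before pi u v.
  move=> not_ba; have [/andP[/eqP -> /eqP ->]|not_ab] := boolP ((u == a) && (v == b)).
    by rewrite before_swap_ab.
  by rewrite before_swap.
have rec_pi : rec pi w x y z.
  rewrite /rec lt_rec !before_of //; apply: contraTN lt_rec => /andP[/eqP -> /eqP ->].
  by clear -lt_ba; lia.
rewrite /balanced_rec /empty_rec left_switchbacks_swap // right_switchbacks_swap //.
exact: M_balanced.
Qed.

Lemma card_inversions_swap :
  #|[set u | inversion pi' u.1 u.2]| < #|[set u | inversion pi u.1 u.2]|.
Proof.
apply: proper_card; rewrite properE; apply/andP; split.
  by apply/subsetP=> -[x y]; rewrite !inE inversion_swap => /andP[].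
apply/subsetPn; exists (a, b); rewrite !inE ?ready_inversion //.
by rewrite inversion_swap !eqxx andbF.
Qed.

Lemma swap_marking_a_nLR : M' a <> [:: L; R].
Proof. by case/swap_marking_LR; rewrite eqxx. Qed.

Lemma swap_marking_b_nRL : M' b <> [:: R; L].
Proof. by case/swap_marking_RL; rewrite eqxx. Qed.

(** The time [t] is common to the first right move of [a] and the first left move of [b], as far as
    these exist. It is positive to leave room for the swap to be inserted, which ends at [t]. *)
Definition synchronized P t : Prop :=
  [/\ motion M' P, P 0 =1 pos pi', 0 < t,
      (forall u, u <= t -> P u a = pos pi b) /\ (forall u, u <= t -> P u b = pos pi a) &
      (forall u, rmove P u a -> rmove P t a) /\ (forall u, lmove P u b -> lmove P t b)].

Lemma motion_of_synchronized P t : synchronized P t ->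
  exists2 Q, motion M Q & Q 0 =1 pos pi.
Proof.
case=> P_motion P0 t_gt0 [Pa Pb] [a_first b_first].
have /marking_forP M_pi := M_marking.
exists (insert_swap P (pos pi a) (pos pi b) t).
  apply: (motion_insert P_motion pos_b ready_lt t_gt0 Pa Pb a_first b_first).
  - by move=> x xa xb; rewrite swap_marking_other.
  - exact: swap_marking_a_nLR.
  - exact: swap_marking_b_nRL.
  (* A left move of [a] reveals a left inversion, so [M a] contains [L] besides its first letter
     [R]. *)
  - move=> u /(lmove_inversion P_motion)[y [lt_ay]]; rewrite !P0 => ya _ _.
    have [la _ ua] := M_pi a; have : L \in M a.
      rewrite la -left_elt_swap //.
      by apply: (@inversion_left_elt _ _ y); rewrite /inversion /before lt_ay.
    by case: (starts_with_R ua Ma_R) => ->.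
  - move=> u /(rmove_inversion P_motion)[y [lt_yb]]; rewrite !P0 => b_y _ _.
    have [_ rb ub] := M_pi b; have : R \in M b.
      rewrite rb -right_elt_swap 1?eq_sym //.
      by apply: (@inversion_right_elt _ _ _ y); rewrite /inversion /before lt_yb.
    by case: (starts_with_L ub Mb_L) => ->.
by move=> x; rewrite /insert_swap t_gt0 P0 pos_swap tpermK.
Qed.

(** * Making the first moves of the pair simultaneous *)

Section SynchronizeMotion.
Variable P : nat -> 'I_n -> 'I_n.
Hypothesis P_motion : motion M' P.
Hypothesis P0 : P 0 =1 pos pi'.

Lemma rmove_a : right_elt pi' a <-> exists u, rmove P u a.
Proof.
split=> [/existsP[y /andP[lt_ya ay]]|[u]].
  have [|u [_ u_r _ _]] := final_crossing P_motion (s := 0) lt_ya; first by rewrite !P0.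
  by exists u.
move=> /(rmove_inversion P_motion)[y [lt_ya]]; rewrite !P0 => ay _ _.
by apply: (@inversion_right_elt _ _ _ y); rewrite /inversion lt_ya.
Qed.

Lemma lmove_b : left_elt pi' b <-> exists u, lmove P u b.
Proof.
split=> [/existsP[y /andP[lt_by yb]]|[u]].
  have [|u [_ _ u_l _]] := final_crossing P_motion (s := 0) lt_by; first by rewrite !P0.
  by exists u.
move=> /(lmove_inversion P_motion)[y [lt_by]]; rewrite !P0 => yb _ _.
by apply: (@inversion_left_elt _ _ y); rewrite /inversion lt_by.
Qed.

Lemma still_a t : (forall u, u < t -> ~~ rmove P u a /\ ~~ lmove P u a) ->
  forall u, u <= t -> P u a = pos pi b.
Proof.
move=> a_static u le_ut; rewrite (static P_motion (leq0n u)) ?P0 ?pos_swap_a //.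
by move=> v /andP[_ lt_vu]; apply: a_static; apply: leq_trans le_ut.
Qed.

Lemma still_b t : (forall u, u < t -> ~~ rmove P u b /\ ~~ lmove P u b) ->
  forall u, u <= t -> P u b = pos pi a.
Proof.
move=> b_static u le_ut; rewrite (static P_motion (leq0n u)) ?P0 ?pos_swap_b //.
by move=> v /andP[_ lt_vu]; apply: b_static; apply: leq_trans le_ut.
Qed.

(** While [a] holds the next position, [b] cannot move right. *)
Lemma blocked_b t : (forall u, ~~ lmove P u b) -> (forall u, u <= t -> P u a = pos pi b) ->
  forall u, u <= t -> P u b = pos pi a.
Proof.
move=> b_nl Pa; elim=> [|u IH] lt_ut; first by rewrite P0 pos_swap_b.
have {}IH := IH (ltnW lt_ut); apply: ord_inj.
have : P u.+1 b != P u.+1 a :> nat by apply: (motion_neq P_motion); rewrite eq_sym.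
have := b_nl u; have := motion_step P_motion u b; rewrite Pa // /lmove IH.
by clear -pos_b; lia.
Qed.

Lemma blocked_a t : (forall u, ~~ rmove P u a) -> (forall u, u <= t -> P u b = pos pi a) ->
  forall u, u <= t -> P u a = pos pi b.
Proof.
move=> a_nr Pb; elim=> [|u IH] lt_ut; first by rewrite P0 pos_swap_a.
have {}IH := IH (ltnW lt_ut); apply: ord_inj.
have : P u.+1 a != P u.+1 b :> nat by apply: (motion_neq P_motion).
have := a_nr u; have := motion_step P_motion u a; rewrite Pb // /rmove IH.
by clear -pos_b; lia.
Qed.

(** The two gap lemmas give [s = ta.+1 + 2 * #|RS|] and [s = tb.+1 + 2 * #|LS|], so it is enough to
    compare the two sets. *)
Lemma first_moves_agree s ta tb a' b' :
  (forall u x, u <= s -> (P u x <= pos pi a) = (P 0 x <= pos pi a)) ->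
  P s a' = pos pi a :> nat -> rmove P s a' ->
  P s b' = (pos pi a).+1 :> nat -> lmove P s b' ->
  rmove P ta a -> (forall u, u < ta -> ~~ rmove P u a /\ ~~ lmove P u a) ->
  lmove P tb b -> (forall u, u < tb -> ~~ rmove P u b /\ ~~ lmove P u b) ->
  ta = tb.
Proof.
move=> closed Pa' a'_s Pb' b'_s a_ta a_static b_tb b_static; have lt_ba := ready_lt.
have Pa : P 0 a = (pos pi a).+1 :> nat by rewrite P0 pos_swap_a.
have Pb : P 0 b = pos pi a :> nat by rewrite P0 pos_swap_b.
have [lt_b'a lt_ab'] := right_gap_time P_motion closed Pa a_static a_ta Pa' a'_s Pb' b'_s.
have [lt_ba' lt_a'b] := left_gap_time P_motion closed Pb b_static b_tb Pa' a'_s Pb' b'_s.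
set LS := [set f | _]; set RS := [set f | _] => s_LS s_RS.
have a'a : a' != a by apply: contraTneq lt_a'b => ->; rewrite Pa Pb; clear; lia.
have a'b : a' != b by apply: contraTneq lt_a'b => ->; rewrite ltnn.
have b'a : b' != a by apply: contraTneq lt_ab' => ->; rewrite ltnn.
have b'b : b' != b by apply: contraTneq lt_ab' => ->; rewrite Pa Pb; clear; lia.
have lt_b'a' : b' < a'.
  have [y [lt_ya' _ _ Py]] := rmove_inversion P_motion a'_s.
  suff -> : b' = y by [].
  by apply: (motion_inj P_motion (t := s)); apply: ord_inj; rewrite Py Pa'.
have P0_other x : x != a -> x != b -> P 0 x = pos pi x by move=> *; rewrite P0 pos_swap_other.
have rec_pi : rec pi a' a b b'.
  rewrite /rec /before pos_b -(P0_other a') // -(P0_other b') //.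
  by move: lt_a'b lt_ab'; rewrite Pa Pb; clear -lt_ba lt_ba' lt_b'a lt_b'a'; lia.
(* In the swapped permutation [a] stands where [b] stood, so starting right of [a] there means
   coming after [b] in [pi]. *)
have RS_def : RS = [set f in right_switchbacks pi M a' a b b' | a' < f < a].
  apply/setP=> f; rewrite !inE.
  have [f_in|] := boolP (a' < f < a); last by rewrite !andbF.
  have fa : f != a by apply: contraTneq f_in => ->; rewrite ltnn andbF.
  have [->|fb] := eqVneq f b; first by rewrite /before Pa Pb !ltnn; clear; lia.
  rewrite swap_marking_other // /before pos_b -(P0_other f) // -(P0_other b') // Pa !andbT.
  by congr (_ && _); rewrite andbA; rewrite /strictly_between; move: f_in; clear; lia.
have LS_def : LS = [set f in left_switchbacks pi M a' a b b' | b < f < b'].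
  apply/setP=> f; rewrite !inE.
  have [f_in|] := boolP (b < f < b'); last by rewrite !andbF.
  have fb : f != b by apply: contraTneq f_in => ->; rewrite ltnn.
  have [->|fa] := eqVneq f a; first by rewrite /before Pa Pb !ltnn; clear; lia.
  rewrite swap_marking_other // /before -(P0_other f) // -(P0_other a') // Pb !andbT.
  by congr (_ && _); rewrite andbA; rewrite /strictly_between; move: f_in; clear; lia.
suff eq_card : #|RS| = #|LS| by move: s_LS s_RS; rewrite eq_card; clear; lia.
(* In a regular rec the value bounds are those of the switchbacks, and balance applies. In an
   irregular one both sets lie in empty sets. *)
have [reg irreg] := M_balanced rec_pi; have [is_reg|not_reg] := boolP (regular a' a b b').
  have -> : RS = right_switchbacks pi M a' a b b'.
    rewrite RS_def; apply/setP=> f; rewrite !inE -!andbA; do 3 congr (_ && _).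
    by move: is_reg; rewrite /regular /strictly_between; clear; lia.
  have -> : LS = left_switchbacks pi M a' a b b'.
    rewrite LS_def; apply/setP=> f; rewrite !inE -!andbA; do 3 congr (_ && _).
    by move: is_reg; rewrite /regular /strictly_between; clear; lia.
  by rewrite (reg is_reg).
have [left0 right0] := irreg not_reg.
have -> : RS = set0 by rewrite RS_def right0; apply/setP=> f; rewrite !inE.
by have -> : LS = set0 by rewrite LS_def left0; apply/setP=> f; rewrite !inE.
Qed.

End SynchronizeMotion.

Lemma exists_synchronized P : motion M' P -> P 0 =1 pos pi' ->
  exists Q t, synchronized Q t.
Proof.
(* All positions are on the left of gap [n], so this is a shift of the whole motion by one time
   unit; every move now happens at a positive time. *)
move=> P_motion0 P00; pose P1 := delay P n 1 1.
have P_motion : motion M' P1.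
  by apply: (motion_delay P_motion0) => u x; rewrite !(ltnW (ltn_ord _)).
have P0 : P1 0 =1 pos pi' by move=> x; rewrite /P1 delay0.
have delay1 x : delay_of P n 1 1 x = 1 by rewrite /delay_of; case: ifP.
have pos_r t x : rmove P1 t x -> 0 < t by rewrite rmove_delay delay1 => /andP[].
have pos_l t x : lmove P1 t x -> 0 < t by rewrite lmove_delay delay1 => /andP[].
clear delay1; clearbody P1.
have [Ra|nRa] := boolP (right_elt pi' a); have [Lb|nLb] := boolP (left_elt pi' b).
- have [ta a_ta a_static] :=
    first_rmove P_motion swap_marking_a_nLR ((rmove_a P_motion P0).1 Ra).
  have [tb b_tb b_static] :=
    first_lmove P_motion swap_marking_b_nRL ((lmove_b P_motion P0).1 Lb).
  have [closed|] := gap_closed_or_first_use P_motion (pos pi a); last first.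
    move=> [s [a' [b' [closed [Pa' [a'_s [Pb' b'_s]]]]]]].
    have eq_t := first_moves_agree P_motion P0 closed Pa' a'_s Pb' b'_s a_ta a_static b_tb b_static.
    exists P1, ta; split=> //; [exact: pos_r a_ta | | by rewrite {2}eq_t].
    by split; [apply: (still_a P_motion P0) | apply: (still_b P_motion P0); rewrite eq_t].
  pose Q := delay P1 (pos pi a) ta tb.
  have Q_motion : motion M' Q by apply: motion_delay.
  have Q0 : Q 0 =1 pos pi' by move=> x; rewrite /Q delay0.
  have delay_a : delay_of P1 (pos pi a) ta tb a = tb.
    by rewrite /delay_of P0 pos_swap_a pos_b; case: leqP => //; clear; lia.
  have delay_b : delay_of P1 (pos pi a) ta tb b = ta.
    by rewrite /delay_of P0 pos_swap_b leqnn.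
  exists Q, (ta + tb); split=> //; first by have := pos_r _ _ a_ta; clear; lia.
    split.
      apply: (still_a Q_motion Q0) => u lt_u; rewrite /Q rmove_delay lmove_delay delay_a.
      by case: (leqP tb u) => //= le_u; apply: a_static; move: lt_u le_u; clear; lia.
    apply: (still_b Q_motion Q0) => u lt_u; rewrite /Q rmove_delay lmove_delay delay_b.
    by case: (leqP ta u) => //= le_u; apply: b_static; move: lt_u le_u; clear; lia.
  split=> u _; rewrite /Q ?rmove_delay ?lmove_delay ?delay_a ?delay_b.
    by rewrite addnK leq_addl.
  by rewrite addKn leq_addr.
(* Only [a] has to move on. Its first right move fixes the time, and until then it blocks [b]. *)
- have nlb u : ~~ lmove P1 u b by apply: contra nLb => ?; apply/(lmove_b P_motion P0); exists u.
  have [ta a_ta a_static] :=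
    first_rmove P_motion swap_marking_a_nLR ((rmove_a P_motion P0).1 Ra).
  have Pa := still_a P_motion P0 a_static.
  exists P1, ta; split=> //; [exact: pos_r a_ta | | by split=> // u; rewrite (negPf (nlb u))].
  by split=> //; apply: (blocked_b P_motion P0).
- have nra u : ~~ rmove P1 u a by apply: contra nRa => ?; apply/(rmove_a P_motion P0); exists u.
  have [tb b_tb b_static] :=
    first_lmove P_motion swap_marking_b_nRL ((lmove_b P_motion P0).1 Lb).
  have Pb := still_b P_motion P0 b_static.
  exists P1, tb; split=> //; [exact: pos_l b_tb | | by split=> // u; rewrite (negPf (nra u))].
  by split=> //; apply: (blocked_a P_motion P0).
(* Neither has to move on, and nothing moves during the first step, so time 1 will do. *)
have nlb u : ~~ lmove P1 u b by apply: contra nLb => ?; apply/(lmove_b P_motion P0); exists u.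
have nra u : ~~ rmove P1 u a by apply: contra nRa => ?; apply/(rmove_a P_motion P0); exists u.
exists P1, 1; split=> //; last by split=> u; rewrite ?(negPf (nra u)) ?(negPf (nlb u)).
split.
  apply: (still_a P_motion P0) => u lt_u1; split=> //.
  by apply/negP=> /pos_l; rewrite ltnS leqn0 in lt_u1; rewrite (eqP lt_u1).
apply: (still_b P_motion P0) => u lt_u1; split=> //.
by apply/negP=> /pos_r; rewrite ltnS leqn0 in lt_u1; rewrite (eqP lt_u1).
Qed.

End SwapReadyPair.

Lemma exists_motion n (pi : 'S_n) (M : marking n) :
  marking_for pi M -> balanced pi M -> aligned pi M ->
  exists2 P, motion M P & P 0 =1 pos pi.
Proof.
have [k] := ubnP #|[set u | inversion pi u.1 u.2]|; elim: k pi M => // k IH pi M.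
rewrite ltnS => le_k M_marking M_balanced M_aligned.
have [/existsP[x /existsP[y inv_xy]]|] := boolP [exists x, exists y, inversion pi x y].
  have [a [b [ab Ma Mb]]] := exists_ready_pair M_marking inv_xy.
  have [||||P P_motion P0] := IH (swap_pair pi a b) (swap_marking pi M a b).
  - exact: leq_trans (card_inversions_swap M_aligned ab Ma Mb) le_k.
  - exact: marking_for_swap.
  - exact: balanced_swap.
  - exact: aligned_swap.
  have [Q [t sync]] := exists_synchronized M_marking M_balanced M_aligned ab Ma Mb P_motion P0.
  exact: motion_of_synchronized sync.
rewrite negb_exists => /forallP no_inv.
exists (fun _ => id); first exact: static_motion.
by move=> x; rewrite no_inversion // => {}x y; have := no_inv x; rewrite negb_exists => /forallP.
Qed.

(** * From motions to tangles *)

(** Pairwise far swaps act on disjoint pairs of positions, so each takes effect as if it were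
    alone. *)
Lemma foldr_swap n (pi : 'S_n) (s : seq 'I_n.-1) : pairwise (@far n) s ->
  [/\ forall i, i \in s -> foldr (@swap n) pi s (ord_this i) = pi (ord_succ i),
      forall i, i \in s -> foldr (@swap n) pi s (ord_succ i) = pi (ord_this i) &
      forall q, (forall i, i \in s -> (q != ord_this i) && (q != ord_succ i)) ->
        foldr (@swap n) pi s q = pi q].
Proof.
elim: s => [|i s IH] //= /andP[/allP far_i /IH[IH1 IH2 IH3]].
have swapE (F : 'S_n) q : swap i F q = F (tperm (ord_this i) (ord_succ i) q).
  by rewrite /swap permM.
have apart j : j \in s -> [&& ord_this i != ord_this j, ord_this i != ord_succ j,
    ord_succ i != ord_this j & ord_succ i != ord_succ j].
  by move=> /far_i; rewrite /far -!val_eqE /=; clear; lia.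
split=> [j|j|q q_out].
- rewrite inE => /orP[/eqP ->|j_in]; rewrite swapE.
    by rewrite tpermL IH3 // => k /apart/and4P[_ _ -> ->].
  by case/and4P: (apart j j_in) => ? ? ? ?; rewrite tpermD ?IH1.
- rewrite inE => /orP[/eqP ->|j_in]; rewrite swapE.
    by rewrite tpermR IH3 // => k /apart/and4P[-> -> _ _].
  by case/and4P: (apart j j_in) => ? ? ? ?; rewrite tpermD ?IH2.
rewrite swapE tpermD.
- by apply: IH3 => j j_in; apply: q_out; rewrite inE j_in orbT.
- by have /andP[+ _] := q_out i (mem_head _ _); rewrite eq_sym.
- by have /andP[_ +] := q_out i (mem_head _ _); rewrite eq_sym.
Qed.

Lemma count_changes (f : nat -> bool) k : (forall t, f t -> f t.+1) ->
  count (fun t => f t != f t.+1) (iota 0 k) = (f 0 != f k).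
Proof.
move=> f_mono; have f0 t : f 0 -> f t by elim: t => // t IH /IH/f_mono.
elim: k => [|k IH]; first by rewrite eqxx.
rewrite -addn1 iotaD count_cat IH /= addn0 addn1.
have := f0 k; have := f_mono k.
by case: (f 0); case: (f k); case: (f k.+1) => //= H1 H2; by [have := H1 isT | have := H2 isT].
Qed.

Lemma convex_interval (Q : pred nat) k : (exists t, Q t) ->
  (forall s t u, Q s -> Q u -> s <= t <= u -> Q t) -> (forall t, Q t -> t < k) ->
  exists u v, [/\ u < v, v <= k & forall t, Q t = (u <= t < v)].
Proof.
move=> ex_Q Q_convex Q_bounded; case: (ex_minnP ex_Q) => u Qu u_min.
case: (@ex_maxnP Q k ex_Q) => [t /Q_bounded/ltnW//|v Qv v_max].
exists u, v.+1; split; [exact: u_min | exact: Q_bounded |] => t.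
apply/idP/idP => [Qt|t_in]; first by rewrite u_min // ltnS v_max.
exact: Q_convex Qu Qv t_in.
Qed.

Lemma count_pmap (T : Type) (A : eqType) (f : T -> option A) l s :
  count (fun x => f x == Some l) s = count_mem l (pmap f s).
Proof. by elim: s => //= x s ->; case: (f x). Qed.

Lemma pmap_None (T : eqType) (A : Type) (f : T -> option A) s :
  (forall x, x \in s -> f x = None) -> pmap f s = [::].
Proof.
elim: s => //= x s IH f_None; rewrite f_None ?mem_head //= IH // => y y_in.
by apply: f_None; rewrite inE y_in orbT.
Qed.

Lemma pmap_single (T : eqType) (A : Type) (f : T -> option A) s p l :
  uniq s -> p \in s -> f p = Some l ->
  (forall x, x \in s -> x != p -> f x = None) -> pmap f s = [:: l].
Proof.
move=> s_uniq /splitPr s_split; case: s_split s_uniq => s1 s2.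
rewrite cat_uniq /= negb_or -andbA => /and4P[_ p_s1 _ /andP[p_s2 _]] fp f_None.
rewrite pmap_cat /= fp /= !pmap_None // => x x_in.
  by apply: f_None; rewrite ?mem_cat ?inE ?x_in ?orbT //; apply: contraNneq p_s2 => <-.
by apply: f_None; rewrite ?mem_cat ?inE ?x_in ?orbT //; apply: contraNneq p_s1 => <-.
Qed.

(** Every item is in relation [r] to all later ones, so the failure of [r p2 p1] puts [p1] first in
    the list. *)
Lemma pmap_double (T : eqType) (A : Type) (r : rel T) (f : T -> option A) s p1 p2 l1 l2 :
  uniq s -> pairwise r s -> p1 \in s -> p2 \in s -> ~~ r p2 p1 ->
  f p1 = Some l1 -> f p2 = Some l2 -> p1 != p2 ->
  (forall x, x \in s -> x != p1 -> x != p2 -> f x = None) -> pmap f s = [:: l1; l2].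
Proof.
move=> s_uniq s_sorted /splitPr s_split; case: s_split s_uniq s_sorted => s1 s2.
rewrite cat_uniq pairwise_cat /= negb_or -andbA allrel_consr.
move=> /and4P[_ p1_s1 _ /andP[p1_s2 s2_uniq]] /andP[/andP[/allP r_s1 _] _].
rewrite mem_cat inE => p2_in not_r fp1 fp2 neq f_None.
have p2_s1 : p2 \notin s1 by apply: contra not_r => /r_s1.
move: p2_in; rewrite (negPf p2_s1) eq_sym (negPf neq) /= => p2_s2.
rewrite pmap_cat /= fp1 /= pmap_None /=; last first.
  move=> x x_in; apply: f_None; rewrite ?mem_cat ?x_in //.
    by apply: contraNneq p1_s1 => <-.
  by apply: contraNneq p2_s1 => <-.
rewrite (@pmap_single _ _ f s2 p2 l2) // => x x_in xp2.
apply: f_None => //; first by rewrite mem_cat inE x_in !orbT.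
by apply: contraNneq p1_s2 => <-.
Qed.

Lemma pairwise_allpairs_fst (s1 s2 : seq nat) : pairwise leq s1 ->
  pairwise (fun p q : nat * nat => p.1 <= q.1) [seq (s, t) | s <- s1, t <- s2].
Proof.
elim: s1 => //= s s1 IH /andP[/allP s_le /IH s1_sorted].
rewrite pairwise_cat s1_sorted andbT; apply/andP; split.
  apply/allrelP=> p q /mapP[t _ ->] /allpairsP[[s' t'] [s'_in _ ->]] /=.
  exact: s_le.
by elim: s2 {IH s1_sorted} => //= t s2 ->; rewrite andbT all_map; apply/allP=> t' _ /=.
Qed.

(** * The tangle of a motion: adjacency, crossings and segments *)

Section TangleOfMotion.
Variables (n : nat) (pi : 'S_n) (M : marking n) (P : nat -> 'I_n -> 'I_n).
Hypothesis P_motion : motion M P.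
Hypothesis M_marking : marking_for pi M.
Hypothesis P0 : P 0 =1 pos pi.
Hypothesis P01 : P 1 =1 P 0.
Variable N : nat.
Hypothesis PN : forall t, N <= t -> P t =1 id.

(** The inverse is taken because a motion sends elements to positions, and a permutation positions
    to elements. *)
Definition perm_at_time t : 'S_n := ((perm (@motion_inj _ _ _ P_motion t))^-1)%g.

Lemma pos_perm_at_time t x : pos (perm_at_time t) x = P t x.
Proof. by rewrite /pos /perm_at_time invgK permE. Qed.

Lemma perm_at_timeK t x : perm_at_time t (P t x) = x.
Proof. by rewrite -pos_perm_at_time /pos permKV. Qed.

(** The swaps are at the positions whose element moves right. The right neighbour of such an element
    moves left, so no two of these positions are consecutive. *)
Lemma adjacent_perm_at_time t : adjacent (perm_at_time t) (perm_at_time t.+1).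
Proof.
pose s := [seq i <- enum 'I_n.-1 | rmove P t (perm_at_time t (ord_this i))].
have Pi q : P t (perm_at_time t q) = q by rewrite -pos_perm_at_time /pos permK.
have not_next i j : i \in s -> j \in s -> j != i.+1 :> nat.
  rewrite !mem_filter => /andP[i_r _] /andP[j_r _]; apply/eqP => eq_j.
  have [y [_ _ y_l Py]] := rmove_inversion P_motion i_r.
  suff eq_y : y = perm_at_time t (ord_this j).
    by move: j_r; rewrite -eq_y lmove_not_rmove.
  by apply: (@motion_inj _ _ _ P_motion t); apply: ord_inj; rewrite Py !Pi /= eq_j.
have s_far : pairwise (@far n) s.
  have : pairwise (fun i j => i != j) s by rewrite -uniq_pairwise filter_uniq ?enum_uniq.
  apply: (@sub_in_pairwise _ [in s]) => [i j i_in j_in|]; last exact/allP.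
  rewrite -val_eqE /far /=.
  by have := not_next i j i_in j_in; have := not_next j i j_in i_in; clear; lia.
have [s_this s_succ s_out] := foldr_swap (perm_at_time t) s_far.
exists s => //; apply/permP => q; set x := perm_at_time t.+1 q.
have Px : P t.+1 x = q by rewrite -pos_perm_at_time /pos permK.
have in_s y : rmove P t y -> exists2 i, i \in s & ord_this i = P t y.
  move=> y_r; have lt_i : P t y < n.-1.
    by have := ltn_ord (P t.+1 y); move: y_r; rewrite /rmove; clear; lia.
  have eq_i : ord_this (Ordinal lt_i) = P t y by apply: ord_inj.
  by exists (Ordinal lt_i); rewrite // mem_filter eq_i perm_at_timeK y_r mem_enum.
have [x_r|x_nr] := boolP (rmove P t x).
  have [i i_in eq_i] := in_s x x_r.
  have -> : q = ord_succ i.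
    by apply: ord_inj; rewrite -Px /= (eqP x_r) -eq_i.
  by rewrite s_succ // eq_i perm_at_timeK.
have [x_l|x_nl] := boolP (lmove P t x).
  have [y [_ _ y_r Py]] := lmove_inversion P_motion x_l; have [i i_in eq_i] := in_s y y_r.
  have -> : q = ord_this i.
    apply: ord_inj; rewrite -Px eq_i.
    by move: x_l; rewrite /lmove; move: Py; clear; lia.
  rewrite s_this // (_ : ord_succ i = P t x) ?perm_at_timeK //.
  by apply: ord_inj; rewrite Py -eq_i.
have Ptx : P t x = q.
  apply: ord_inj; rewrite -Px; have := motion_step P_motion t x.
  by move: x_nr x_nl; rewrite /rmove /lmove; clear; lia.
rewrite s_out; first by rewrite -Ptx perm_at_timeK.
move=> i i_in; apply/andP; split; apply/eqP=> eq_q.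
  by move: i_in; rewrite mem_filter -eq_q -Ptx perm_at_timeK (negPf x_nr).
move: i_in; rewrite mem_filter => /andP[/(rmove_inversion P_motion)[y [_ _ y_l Py]] _].
suff eq_y : y = x by rewrite -eq_y y_l in x_nl.
by apply: (@motion_inj _ _ _ P_motion t); apply: ord_inj; rewrite Py Pi Ptx eq_q.
Qed.

(** The times run from 0 to [N.+1]. The last two permutations, at [N] and [N.+1], are both the
    identity, which the convention on the end of a tangle demands. *)
Definition tangle_of_motion : seq 'S_n := mkseq perm_at_time N.+2.
Local Notation T := tangle_of_motion.

Lemma size_tangle_of_motion : size T = N.+2.
Proof. exact: size_mkseq. Qed.

Lemma final_time_of_motion : final_time T = N.+1.
Proof. by rewrite /final_time size_mkseq. Qed.

Lemma perm_at_of_motion t : t <= N.+1 -> perm_at T t = perm_at_time t.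
Proof. by move=> le_t; rewrite /perm_at nth_mkseq. Qed.

Lemma path_pos_of_motion x t : t <= N.+1 -> path_pos T x t = P t x.
Proof. by move=> le_t; rewrite /path_pos perm_at_of_motion // pos_perm_at_time. Qed.

Lemma solves_of_motion : 0 < N -> solves T pi.
Proof.
move=> N_gt0; have ext t (rho : 'S_n) : P t =1 pos rho -> perm_at_time t = rho.
  move=> Pt; apply: invg_inj; apply/permP => x.
  exact: etrans (pos_perm_at_time t x) (Pt x).
have fin t : N <= t -> perm_at_time t = 1%g.
  by move=> le_t; apply: ext => x; rewrite PN // /pos invg1 perm1.
rewrite /solves final_time_of_motion succnK !perm_at_of_motion //.
rewrite (fin N) // (fin N.+1) //; split=> //.
- split; first by rewrite size_mkseq.
  move=> t; rewrite final_time_of_motion => lt_t.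
  by rewrite !perm_at_of_motion // 1?ltnW //; apply: adjacent_perm_at_time.
- exact: ext.
by split=> //; rewrite (ext 0 pi) // (ext 1 pi) // => x; rewrite P01 P0.
Qed.

Lemma nb_crossings_of_motion a b : a != b -> nb_crossings T a b <= 1.
Proof.
move=> neq_ab; rewrite /nb_crossings final_time_of_motion.
rewrite (@eq_in_count _ _ (fun t => (P t a < P t b) != (P t.+1 a < P t.+1 b))); last first.
  move=> t; rewrite mem_iota add0n => /andP[_ lt_t].
  by rewrite /before !perm_at_of_motion ?pos_perm_at_time // ltnW.
have [lt_ab|lt_ba|/ord_inj eq_ab] := ltngtP a b; last by rewrite eq_ab eqxx in neq_ab.
  rewrite (count_changes (f := fun t => P t a < P t b)); first exact: leq_b1.
  by move=> t; apply: (motion_mono P_motion).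
rewrite (@eq_count _ _ (fun t => (P t b < P t a) != (P t.+1 b < P t.+1 a))).
  rewrite (count_changes (f := fun t => P t b < P t a)); first exact: leq_b1.
  by move=> t; apply: (motion_mono P_motion).
move=> t; have := motion_neq P_motion t neq_ab; have := motion_neq P_motion t.+1 neq_ab.
by clear; lia.
Qed.

Definition moves (l : letter) t x : bool := if l is R then rmove P t x else lmove P t x.

Definition direction (l : letter) : int := if l is R then 1%R else (-1)%R.

Lemma step_direction x t : t <= N ->
  (exists2 l, moves l t x & step T x t = direction l) \/
  [/\ ~~ rmove P t x, ~~ lmove P t x & step T x t = 0%R].
Proof.
move=> le_t; rewrite /step !path_pos_of_motion ?(leqW le_t) //.
have step_x := motion_step P_motion t x; have [x_r|x_nr] := boolP (rmove P t x).
  by left; exists R => //; move: x_r; rewrite /rmove /direction; clear; lia.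
have [x_l|x_nl] := boolP (lmove P t x).
  by left; exists L => //; move: x_l; rewrite /lmove /direction; clear; lia.
by right; split=> //; move: x_nr x_nl; rewrite /rmove /lmove; clear -step_x; lia.
Qed.

Lemma moves_uniq l l' t x : moves l t x -> moves l' t x -> l = l'.
Proof.
by case: l; case: l' => //=; [move=> /lmove_not_rmove-> | move=> + /lmove_not_rmove => ->].
Qed.

Lemma step_moves l x t : t <= N -> (step T x t == direction l) = moves l t x.
Proof.
move=> le_t; have [[l' x_l' ->]|[x_nr x_nl ->]] := step_direction x le_t.
  apply/eqP/idP => [eq_d|/(moves_uniq x_l')->//].
  by have -> : l = l' by case: l l' eq_d {x_l'} => -[].
by case: l; rewrite /= ?(negPf x_nr) ?(negPf x_nl).
Qed.

Lemma straight_step x s t w : straight T x s t -> s <= w < t ->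
  w <= N /\ step T x w = step T x s.
Proof.
rewrite /straight final_time_of_motion => /and3P[lt_st le_t /allP same] w_in.
split; first by move: w_in le_t; clear; lia.
by apply/eqP/same; rewrite mem_iota; move: w_in lt_st; clear; lia.
Qed.

Lemma straight_moves l x s t w : straight T x s t -> s <= w < t ->
  moves l w x = moves l s x.
Proof.
move=> st w_in; have [le_w eq_w] := straight_step st w_in.
have lt_st : s < t by case/and3P: st.
have [le_s _] : s <= N /\ step T x s = step T x s by apply: straight_step st _; rewrite leqnn.
by rewrite -!step_moves // eq_w.
Qed.

Lemma segment_letter_of_motion x s t : straight T x s t ->
  segment_letter T x (s, t) =
    if moves R s x then Some R else if moves L s x then Some L else None.
Proof.
move=> st; have mv l w := straight_moves l (w := w) st.
have [lt_st le_t] : s < t /\ t <= N.+1.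
  by case/and3P: st => ? + _; rewrite final_time_of_motion.
rewrite /segment_letter /= !path_pos_of_motion //; last by rewrite ltnW // (leq_trans lt_st).
have [x_r|x_nr] := boolP (rmove P s x).
  have -> : P t x = P s x + (t - s) :> nat.
    by apply: (rmove_run (ltnW lt_st)) => w /(mv R) /= ->.
  by rewrite ltnNge leq_addr /= -[X in X < _]addn0 ltn_add2l subn_gt0 lt_st.
have [x_l|x_nl] := boolP (lmove P s x).
  have -> : P s x = P t x + (t - s) :> nat.
    by apply: (lmove_run (ltnW lt_st)) => w /(mv L) /= ->.
  by rewrite -[X in X < _]addn0 ltn_add2l subn_gt0 lt_st.
rewrite (static P_motion (ltnW lt_st)) ?ltnn // => w w_in.
by have /= -> := mv R w w_in; have /= -> := mv L w w_in.
Qed.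

(** The interval of all moves of kind [l] is straight, and a straight piece starting with such a
    move lies inside it; maximality leaves only the whole interval. *)
Lemma segment_moves l x u v s t : u < v -> v <= N ->
  (forall w, moves l w x = (u <= w < v)) -> moves l s x ->
  segment T x s t = ((s, t) == (u, v)).
Proof.
move=> lt_uv le_v mvE x_s.
have size_T := size_tangle_of_motion.
have uv : straight T x u v.
  rewrite /straight lt_uv final_time_of_motion (leqW le_v) /=; apply/allP=> w.
  rewrite mem_iota => w_in; have [le_w le_u] : w <= N /\ u <= N.
    by move: w_in lt_uv le_v; clear; lia.
  have /eqP -> : step T x w == direction l.
    by rewrite step_moves // mvE; move: w_in lt_uv; clear; lia.
  by rewrite eq_sym step_moves // mvE leqnn.
apply/idP/eqP => [/andP[st /forallP max_st]|[-> ->]].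
  have lt_u : u < size T by rewrite size_T; move: lt_uv le_v; clear; lia.
  have lt_v : v < size T by rewrite size_T; move: le_v; clear; lia.
  have lt_st : s < t by case/and3P: st.
  have := max_st (Ordinal lt_u) => /forallP/(_ (Ordinal lt_v)) /=.
  have le_t : t.-1 < v.
    have := straight_moves l (w := t.-1) st; rewrite x_s mvE.
    by move=> /(_ _)/andP[]//; move: lt_st; clear; lia.
  move: x_s; rewrite mvE uv => /andP[-> _] /=.
  have -> : t <= v by move: le_t lt_st; clear; lia.
  by move=> /andP[/eqP -> /eqP ->].
apply/andP; split=> //; apply/forallP=> s'; apply/forallP=> t'; apply/implyP.
case/and3P=> le_s' le_t' st'.
have mv w : s' <= w < t' -> u <= w < v.
  move=> w_in; rewrite -mvE (straight_moves l st' w_in).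
  rewrite -(straight_moves l st' (w := u)) ?mvE ?leqnn //.
  by move: lt_uv le_s' le_t'; clear; lia.
have := mv s'; have := mv t'.-1; move: lt_uv le_s' le_t'; clear; lia.
Qed.

Lemma mem_segments x s t : ((s, t) \in segments T x) = (s < N.+2) && (t < N.+2) && segment T x s t.
Proof.
rewrite /segments mem_filter andbC size_tangle_of_motion; congr (_ && _).
apply/allpairsP/andP => [[[s' t'] [s'_in t'_in [-> ->]]]|[lt_s lt_t]].
  by move: s'_in t'_in; rewrite !mem_iota.
by exists (s, t); rewrite !mem_iota.
Qed.

Lemma segments_uniq x : uniq (segments T x).
Proof. by rewrite filter_uniq // allpairs_uniq ?iota_uniq // => -[? ?] [? ?]. Qed.

Lemma segments_sorted x : pairwise (fun p q : nat * nat => p.1 <= q.1) (segments T x).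
Proof.
apply: pairwise_filter; apply: pairwise_allpairs_fst.
by rewrite -sorted_pairwise ?iota_sorted //; exact: leq_trans.
Qed.

(** By convexity the moves of one kind fill an interval of times, which is then the only segment of
    that kind. *)
Lemma segment_of_letter l x : (exists t, moves l t x) ->
  exists p, [/\ p \in segments T x, segment_letter T x p = Some l, moves l p.1 x &
    forall q, q \in segments T x -> q != p -> ~~ moves l q.1 x].
Proof.
move=> ex_l; have bounded t : moves l t x -> t < N.
  rewrite ltnNge; apply: contraL => le_t.
  by case: l {ex_l}; rewrite /= /lmove /rmove !PN ?leqW //; clear; lia.
have [|u [v [lt_uv le_v mvE]]] := convex_interval ex_l _ bounded.
  by case: l {ex_l bounded} => s t u;
    [apply: (lmove_convex P_motion) | apply: (rmove_convex P_motion)].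
have mv_u : moves l u x by rewrite mvE leqnn.
have seg_uv : segment T x u v by rewrite (segment_moves _ lt_uv le_v mvE mv_u).
exists (u, v); split=> //=.
- by rewrite mem_segments seg_uv; move: lt_uv le_v; clear; lia.
- have uv : straight T x u v by case/andP: seg_uv.
  rewrite segment_letter_of_motion //; case: l mv_u {ex_l bounded mvE} => /= mv_u.
    by rewrite lmove_not_rmove // mv_u.
  by rewrite mv_u.
move=> [s t]; rewrite mem_segments => /andP[_ seg_st]; apply: contra => mv_s /=.
by rewrite -(segment_moves t lt_uv le_v mvE mv_s).
Qed.

(** A motion refers to [M] only for the order of the two kinds of moves. Which kinds occur follows
    from the inversions of [pi]: a path moves right (left) at some time exactly when its element is
    right (left). *)
Lemma tangle_marking_of_motion x : tangle_marking T x = M x.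
Proof.
have /marking_forP/(_ x)[lx rx ux] := M_marking.
have ex_R : (R \in M x) <-> exists t, moves R t x.
  rewrite rx; split=> [/existsP[y /andP[lt_yx xy]]|[t]].
    have [|t [_ x_r _ _]] := final_crossing P_motion (s := 0) lt_yx; first by rewrite !P0.
    by exists t.
  move=> /(rmove_inversion P_motion)[y [lt_yx]]; rewrite !P0 => xy _ _.
  by apply: (@inversion_right_elt _ _ _ y); rewrite /inversion lt_yx.
have ex_L : (L \in M x) <-> exists t, moves L t x.
  rewrite lx; split=> [/existsP[y /andP[lt_xy yx]]|[t]].
    have [|t [_ _ x_l _]] := final_crossing P_motion (s := 0) lt_xy; first by rewrite !P0.
    by exists t.
  move=> /(lmove_inversion P_motion)[y [lt_xy]]; rewrite !P0 => yx _ _.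
  by apply: (@inversion_left_elt _ _ y); rewrite /inversion lt_xy.
have letterE p : p \in segments T x -> segment_letter T x p =
    if moves R p.1 x then Some R else if moves L p.1 x then Some L else None.
  case: p => s t; rewrite mem_segments => /andP[_ /andP[st _]].
  exact: segment_letter_of_motion.
have none l t : l \notin M x -> moves l t x = false.
  move=> l_out; apply: contraNF l_out => mv.
  by case: l mv => mv; [apply/ex_L | apply/ex_R]; exists t.
have single l : l \in M x -> (forall l', l' != l -> l' \notin M x) ->
    tangle_marking T x = [:: l].
  move=> l_in l_only; have [|p [p_in fp _ p_only]] := @segment_of_letter l x.
    by case: l l_in {l_only}; [move/ex_L | move/ex_R].
  apply: (pmap_single (segments_uniq x) p_in fp) => q q_in neq_q.
  rewrite letterE //; have := p_only q q_in neq_q.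
  by case: l l_only {l_in fp p_only} => l_only /negPf ->;
    rewrite (none _ _ (l_only _ _)) //; case: ifP.
have double l1 l2 : M x = [:: l1; l2] -> tangle_marking T x = [:: l1; l2].
  move=> Mx; rewrite Mx /= andbT inE in ux.
  have ex l : l \in M x -> exists t, moves l t x by case: l; [move/ex_L | move/ex_R].
  have [|p1 [p1_in fp1 mv1 p1_only]] := @segment_of_letter l1 x.
    by apply: ex; rewrite Mx mem_head.
  have [|p2 [p2_in fp2 mv2 p2_only]] := @segment_of_letter l2 x.
    by apply: ex; rewrite Mx !inE eqxx orbT.
  have neq_p : p1 != p2.
    by apply: contraNneq ux => eq_p; rewrite eq_p in mv1; rewrite (moves_uniq mv1 mv2).
  (* Segments are listed by starting time. If the one with letter [l2] started first, the motion
     would force [M x = [:: l2; l1]]. *)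
  apply: (pmap_double (segments_uniq x) (segments_sorted x) p1_in p2_in _ fp1 fp2 neq_p).
    rewrite -ltnNge ltn_neqAle; apply/andP; split.
      by apply: contraNneq ux => eq_p; rewrite eq_p in mv1; rewrite (moves_uniq mv1 mv2).
    rewrite leqNgt; apply/negP=> lt_p; move: ux Mx.
    case: l1 mv1 {fp1 p1_only} => mv1; case: l2 mv2 {fp2 p2_only} => mv2 //= _.
      by rewrite (rmove_lmove P_motion mv2 mv1 lt_p).
    by rewrite (lmove_rmove P_motion mv2 mv1 lt_p).
  move=> q q_in q1 q2; rewrite letterE //.
  have := p1_only q q_in q1; have := p2_only q q_in q2.
  by case: l1 l2 ux {Mx fp1 fp2 mv1 mv2 p1_only p2_only} => -[] //= _ /negPf -> /negPf ->.
case Mx: (M x) ux => [|l1 [|l2 [|l3 s]]] ux.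
- apply: pmap_None => p p_in; rewrite letterE //.
  by rewrite !none // Mx.
- apply: single; first by rewrite Mx mem_head.
  by move=> l' neq_l'; rewrite Mx inE.
- exact: double.
by move: ux {Mx}; rewrite /= !inE; case: l1; case: l2; case: l3; rewrite //= ?andbF.
Qed.

End TangleOfMotion.

Theorem theorem4 (n : nat) (pi : 'S_n) (M : marking n)
    (M_marking : marking_for pi M)
    (M_balanced : balanced pi M)
    (M_aligned : aligned pi M) :
  exists T : seq 'S_n,
    perfect_tangle T pi /\ (forall i : 'I_n, tangle_marking T i = M i).
Proof.
have [P P_motion0 P00] := exists_motion M_marking M_balanced M_aligned.
(* The shift by one time unit creates an initial step without moves, as the convention on the start
   of a tangle demands. *)
pose P1 := delay P n 1 1.
have P_motion : motion M P1.
  by apply: (motion_delay P_motion0) => u x; rewrite !(ltnW (ltn_ord _)).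
have P0 : P1 0 =1 pos pi by move=> x; rewrite /P1 delay0.
have P01 : P1 1 =1 P1 0 by move=> x; rewrite /P1 /delay /delay_of; case: ifP.
have [N PN] := motion_final P_motion.
have PN1 t : N.+1 <= t -> P1 t =1 id by move=> lt_t; apply: PN; apply: ltnW.
have marked := tangle_marking_of_motion P_motion M_marking P0 PN1.
exists (tangle_of_motion P_motion N.+1); split=> //; split.
  split; first exact: solves_of_motion.
  by move=> a b; apply: nb_crossings_of_motion.
(* The number of segments with a given letter is the multiplicity of that letter in [M x], which has
   no repetition. *)
move=> x; have /marking_forP/(_ x)[_ _ ux] := M_marking.
by rewrite /nb_segments !count_pmap -/(tangle_marking _ x) marked !(count_uniq_mem _ ux) !leq_b1.
Qed.
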